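(* Assume that $\rho$ satisfies: $\rho\in H^2(0,\pi)$, $0<\rho(x)\le\beta_0$ for all $x\in[0,\pi]$ (for some constant $\beta_0$), and $\rho_0=\operatorname{ess\,inf}\eta_\rho>0$. Let $0<p<1$, let the boundary conditions be the Dirichlet ones, i.e. $\alpha_1>0,\ \beta_1=0,\ \alpha_2>0,\ \beta_2=0$, and let $\mu$ be a real constant with $\mu\notin\Lambda(L)$ and $\mu>\rho_1$, where $\rho_1=\frac{2}{\pi}\int_0^\pi\eta_\rho(x)\,dx$. Then the problem $$\rho(x)u_{tt}-(\rho(x)u_x)_x=\mu\rho(x)u+\rho(x)|u|^{p-1}u,\quad (t,x)\in\Omega,$$ $$a_1u(t,0)+b_1u_x(t,0)=0,\quad a_2u(t,\pi)+b_2u_x(t,\pi)=0,\quad t\in(0,T),$$ $$u(0,x)=u(T,x),\quad u_t(0,x)=u_t(T,x),\quad x\in(0,\pi),$$ has infinitely many periodic weak solutions $u_l$ satisfying $$\int_\Omega|u_l|^{p+1}\rho\,dt\,dx\to0\quad\text{as } l\to\infty.$$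
   Context: $T=2\pi a/b$ with $a,b$ relatively prime positive integers; $\Omega=(0,T)\times(0,\pi)$; $a_i,b_i\in\mathbb R$ with $a_i^2+b_i^2\ne0$ for $i=1,2$. Unknown functions $u$ are real-valued. $\eta_\rho=\frac12\frac{\rho''}{\rho}-\frac14\left(\frac{\rho'}{\rho}\right)^2$. Also $\alpha_1=a_1-\frac{b_1}{2}\frac{\rho'(0)}{\rho(0)}$, $\alpha_2=a_2-\frac{b_2}{2}\frac{\rho'(\pi)}{\rho(\pi)}$, $\beta_1=-b_1$, $\beta_2=b_2$. For $r\ge1$, $L^r(\Omega)$ is the space of $u$ with $\|u\|_{L^r(\Omega)}^r=\int_\Omega|u|^r\rho\,dt\,dx<\infty$. $\Psi$ is the set of functions $\psi$ that are $C^\infty$ on $\Omega$ up to the boundary and satisfy $a_1\psi(t,0)+b_1\psi_x(t,0)=0$, $a_2\psi(t,\pi)+b_2\psi_x(t,\pi)=0$, $\psi(0,x)=\psi(T,x)$, $\psi_t(0,x)=\psi_t(T,x)$. A function $u\in L^r(\Omega)$ is a weak solution of the problem if $\int_\Omega u(\rho\psi_{tt}-(\rho\psi_x)_x)\,dt\,dx-\int_\Omega(\mu u+|u|^{p-1}u)\psi\rho\,dt\,dx=0$ for all $\psi\in\Psi$. Let $\lambda_k^2$ be the eigenvalues (listed increasingly) of the Sturm–Liouville problem $-(\rho\varphi')'=\lambda^2\rho\varphi$ on $(0,\pi)$, $a_1\varphi(0)+b_1\varphi'(0)=0$, $a_2\varphi(\pi)+b_2\varphi'(\pi)=0$, and let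 $\nu_j=2\pi j/T$, $j\in\mathbb Z$. Then $\Lambda(L)$ denotes the set of all numbers $\lambda_{jk}=\lambda_k^2-\nu_j^2$; these are the eigenvalues of the wave operator $L$ (the self-adjoint extension to $L^2(\Omega)$ of $\psi\mapsto\rho^{-1}(\rho\psi_{tt}-(\rho\psi_x)_x)$, $\psi\in\Psi$). *)

(* Defs.v *)
From HB Require Import structures.
From mathcomp Require Import all_boot all_order all_algebra.
From mathcomp Require Import all_classical all_reals all_analysis.
From mathcomp Require Import ess_sup_inf.

Set Implicit Arguments.
Unset Strict Implicit.
Unset Printing Implicit Defensive.

Import Order.TTheory GRing.Theory Num.Theory.
Import numFieldNormedType.Exports.

Local Open Scope classical_set_scope.
Local Open Scope ring_scope.

Section Coefficient.
Context {R : realType}.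
Implicit Types f g rho drho ddrho : R -> R.

Definition I0pi : set R := `]0, pi[.

Lemma measurable_I0pi : measurable (I0pi : set (measurableTypeR R)).
Proof. exact: measurable_itv. Qed.

Definition L2_0pi f : Prop :=
  measurable_fun I0pi f /\
  (\int[lebesgue_measure]_(x in I0pi) ((f x) ^+ 2)%:E < +oo)%E.

Definition Cc_infty_0pi (phi : R -> R) : Prop :=
  (forall n x, derivable (derive1n n phi) x 1) /\
  exists c d : R, [/\ 0 < c, d < pi &
    forall x, ~ (c <= x <= d) -> phi x = 0].

Definition weak_derivative_0pi f g : Prop :=
  forall phi, Cc_infty_0pi phi ->
    \int[lebesgue_measure]_(x in I0pi) (f x * derive1 phi x) =
    - \int[lebesgue_measure]_(x in I0pi) (g x * phi x).

(* rho is in H^2(0,pi), with weak derivatives drho and ddrho. As H^2(0,pi)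
   embeds in C^1([0,pi]), rho and drho are taken to be the continuous
   representatives, so that their values at 0 and pi make sense; ddrho is
   determined almost everywhere. *)
Definition H2_0pi rho drho ddrho : Prop :=
  [/\ L2_0pi rho, L2_0pi drho & L2_0pi ddrho] /\
  [/\ weak_derivative_0pi rho drho, weak_derivative_0pi drho ddrho,
      {within `[0, pi], continuous rho} & {within `[0, pi], continuous drho}].

Definition eta_rho rho drho ddrho (x : R) : R :=
  2^-1 * (ddrho x / rho x) - 4^-1 * (drho x / rho x) ^+ 2.

Definition rho_0 rho drho ddrho : \bar R :=
  ess_inf (mrestr lebesgue_measure measurable_I0pi)
    (fun x => (eta_rho rho drho ddrho x)%:E).

Definition rho_1 rho drho ddrho : R :=
  2 / pi * \int[lebesgue_measure]_(x in I0pi) eta_rho rho drho ddrho x.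

Definition alpha1 rho drho (a1 b1 : R) : R := a1 - b1 / 2 * (drho 0 / rho 0).
Definition alpha2 rho drho (a2 b2 : R) : R := a2 - b2 / 2 * (drho pi / rho pi).
Definition beta1 (b1 : R) : R := - b1.
Definition beta2 (b2 : R) : R := b2.

End Coefficient.

Section Spectrum.
Context {R : realType}.

(* lambda2 stands for the eigenvalue lambda^2, as a real number of any sign.
   dphi is the derivative of phi, extended continuously to the end points.
   rho and dphi being continuous, the equation is satisfied classically. *)
Definition SL_eigenvalue (rho : R -> R) (a1 b1 a2 b2 lambda2 : R) : Prop :=
  exists phi dphi : R -> R,
  [/\ {within `[0, pi], continuous phi},
      {within `[0, pi], continuous dphi},
      (forall x, 0 < x < pi -> is_derive x 1 phi (dphi x)) &
      (forall x, 0 < x < pi ->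
        is_derive x 1 (fun y => rho y * dphi y) (- (lambda2 * rho x * phi x)))]
  /\
  [/\ a1 * phi 0 + b1 * dphi 0 = 0,
      a2 * phi pi + b2 * dphi pi = 0 &
      exists2 x, 0 <= x <= pi & phi x != 0].

Definition nu (T : R) (j : int) : R := 2 * pi * j%:~R / T.

Definition Lambda (rho : R -> R) (a1 b1 a2 b2 T : R) : set R :=
  [set lambda | exists lambda2 (j : int),
    SL_eigenvalue rho a1 b1 a2 b2 lambda2 /\ lambda = lambda2 - nu T j ^+ 2].

End Spectrum.

Section WeakSolutions.
Context {R : realType}.
Implicit Types (rho : R -> R) (u : R * R -> R) (D : nat -> nat -> R -> R -> R).

Definition Omega (T : R) : set (R * R) := `]0, T[ `*` `]0, pi[.

Definition leb2 :
    {measure set (measurableTypeR R * measurableTypeR R) -> \bar R} :=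
  (lebesgue_measure \x lebesgue_measure)%E.

Definition Lr_mass rho (T r : R) u : \bar R :=
  (\int[leb2]_(z in Omega T) ((`|u z| `^ r) * rho z.2)%:E)%E.

Definition in_Lr rho (T r : R) u : Prop :=
  measurable_fun (Omega T : set (measurableTypeR R * measurableTypeR R)) u /\
  (Lr_mass rho T r u < +oo)%E.

(* A function psi that is C^infty on Omega up to the boundary is given by the
   family D of its partial derivatives, D i j t x being the continuous
   extension to the closed rectangle of d^i/dt^i d^j/dx^j psi; psi itself is
   D 0 0. The whole family is determined on [0,T] x [0,pi] by psi on Omega. *)
Definition smooth_up_to_boundary (T : R) D : Prop :=
  forall i j,
  [/\ {within `[0, T] `*` `[0, pi],
        continuous (fun z : R * R => D i j z.1 z.2)},
      (forall t x, Omega T (t, x) ->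
        is_derive t 1 (fun s => D i j s x) (D i.+1 j t x)) &
      (forall t x, Omega T (t, x) ->
        is_derive x 1 (fun y => D i j t y) (D i j.+1 t x))].

Definition Psi (a1 b1 a2 b2 T : R) D : Prop :=
  [/\ smooth_up_to_boundary T D,
      (forall t, 0 <= t <= T -> a1 * D 0%N 0%N t 0 + b1 * D 0%N 1%N t 0 = 0),
      (forall t, 0 <= t <= T -> a2 * D 0%N 0%N t pi + b2 * D 0%N 1%N t pi = 0),
      (forall x, 0 <= x <= pi -> D 0%N 0%N 0 x = D 0%N 0%N T x) &
      (forall x, 0 <= x <= pi -> D 1%N 0%N 0 x = D 1%N 0%N T x)].

(* r is the exponent of the space L^r(Omega) in which u is sought. Where u z = 0
   the term |u|^(p-1) u is 0, as powR is a total function. *)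
Definition weak_solution rho (a1 b1 a2 b2 T mu p r : R) u : Prop :=
  in_Lr rho T r u /\
  forall D, Psi a1 b1 a2 b2 T D ->
    \int[leb2]_(z in Omega T)
       (u z * (rho z.2 * D 2%N 0%N z.1 z.2
               - derive1 (fun x => rho x * D 0%N 1%N z.1 x) z.2))
    - \int[leb2]_(z in Omega T)
       ((mu * u z + `|u z| `^ (p - 1) * u z) * D 0%N 0%N z.1 z.2 * rho z.2)
    = 0.

Definition ae_equal_on_Omega (T : R) (u v : R * R -> R) : Prop :=
  {ae leb2, forall z, Omega T z -> u z = v z}.

End WeakSolutions.

(* Main.v *)
Require Import Defs.
From HB Require Import structures.
From mathcomp Require Import all_boot all_order all_algebra.
From mathcomp Require Import all_classical all_reals all_analysis.
From mathcomp Require Import measurable_realfun ring lra.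

Set Implicit Arguments.
Unset Strict Implicit.
Unset Printing Implicit Defensive.

Import Order.TTheory GRing.Theory Num.Theory.
Import numFieldNormedType.Exports.

Local Open Scope classical_set_scope.
Local Open Scope ring_scope.

(** Solutions independent of t suffice. For u(t, x) = u(x), the term
    u rho psi_tt integrates to 0 over a period, and the weak equation reduces to
    the Dirichlet problem
      (rho u')' + rho (mu u + |u|^(p-1) u) = 0,   u(0) = u(pi) = 0
    (stationary_weak_solution: the integrand is a t-derivative plus an
    x-derivative, and Fubini's theorem is used in both orders).

    As 0 < p < 1, the nonlinear term dominates near u = 0: the smaller a solution
    of the equation, the faster it oscillates. Solutions starting at u(0) = 0 with
    a small slope thus have many zeros before pi, and these move continuously
    with the slope, so that infinitely many slopes, accumulating at 0, put a zero
    at pi. This gives, for every e > 0, a nonzero solution with |u| <= e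
    (small_solution). A sequence of such solutions, each bounded by half of a
    value taken by the preceding one, consists of distinct functions and its
    L^(p+1) masses tend to 0.

    The slope argument needs continuous dependence on the initial data, whereas
    |u|^(p-1) u is not Lipschitz at u = 0. The remedy is to take as unknown U with
    u = U |U|^gam, gam = (1 - p)/(1 + p), and as independent variable the angle t
    of the polar coordinates U = R sin t, rho u' = R cos t: the position x and the
    logarithm of R then satisfy a Lipschitz system (picard_lindelof applies), and
    u vanishes exactly when t is a multiple of pi. One looks for an initial R for
    which x = pi at t = n pi (shooting): for n fixed, x(n pi) tends to 0 with the
    initial R (traj_upper), and for a fixed initial R it exceeds pi when n is
    large (traj_growth). That R stays comparable to its initial value while
    x <= pi, however large n is, comes from an energy estimate (traj_apriori),
    in which the derivative of rho enters.

    That estimate and the weak equation use that rho is of class C^1. Here rho is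
    given by weak derivatives, and its continuous weak derivative is shown to be a
    classical one by testing with smooth bumps (weak_derivative_classical). *)

(** * Increments, derivatives and primitives *)

Lemma is_derive_continuous (R : realType) (f : R -> R) (x d : R) :
  is_derive x 1 f d -> {for x, continuous f}.
Proof.
by move=> [df _]; apply/differentiable_continuous/derivable1_diffP.
Qed.

Lemma le_increment (R : realType) (f g f' g' : R -> R) (a b : R) :
  a <= b ->
  {within `[a, b], continuous f} -> {within `[a, b], continuous g} ->
  (forall x, a < x < b -> is_derive x 1 f (f' x)) ->
  (forall x, a < x < b -> is_derive x 1 g (g' x)) ->
  (forall x, a < x < b -> f' x <= g' x) ->
  f b - f a <= g b - g a.
Proof.
rewrite le_eqVlt => /predU1P[-> *|ab cf cg df dg fg]; first by rewrite !subrr.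
have [x||x] := @MVT _ (g \- f) (g' \- f') a b ab.
- rewrite in_itv/= => xab; have := df x xab; have := dg x xab.
  by move=> ? ?; apply: is_deriveB.
- by move=> z; apply: cvgB; [exact: cg|exact: cf].
- rewrite in_itv/= => xab /= E.
  rewrite -subr_ge0 (_ : _ - _ = g b - f b - (g a - f a)); last by ring.
  by rewrite E mulr_ge0 ?subr_ge0 ?fg// ltW.
Qed.

Lemma norm_increment (R : realType) (f g f' g' : R -> R) (a b : R) :
  a <= b ->
  {within `[a, b], continuous f} -> {within `[a, b], continuous g} ->
  (forall x, a < x < b -> is_derive x 1 f (f' x)) ->
  (forall x, a < x < b -> is_derive x 1 g (g' x)) ->
  (forall x, a < x < b -> `|f' x| <= g' x) ->
  `|f b - f a| <= g b - g a.
Proof.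
move=> ab cf cg df dg fg; rewrite ler_norml; apply/andP; split; last first.
  apply: (@le_increment _ f g f' g') => // x xab.
  by rewrite (le_trans (ler_norm _))// fg.
rewrite lerNl opprB.
have := @le_increment _ (\- f) g (\- f') g' a b ab.
move=> /(_ _ cg _ dg) H; rewrite (le_trans _ (H _ _ _))//=.
- by rewrite opprK addrC.
- by move=> z; apply: cvgN; exact: cf.
- by move=> x xab; have := df x xab => ?; apply: is_deriveN.
- by move=> x xab; rewrite (le_trans (ler_norm _))// normrN fg.
Qed.

Lemma derive_zero_constant (R : realType) (f : R -> R) (a b : R) :
  a <= b -> {within `[a, b], continuous f} ->
  (forall x, a < x < b -> is_derive x 1 f 0) -> f b = f a.
Proof.
move=> ab cf df; apply/eqP; rewrite -subr_eq0 -normr_le0.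
rewrite -[leRHS](subrr (0 : R)).
apply: (@norm_increment _ f (fun=> 0) (fun=> 0) (fun=> 0)) => //.
- by move=> z; apply: cvg_cst.
- by move=> x _; rewrite normr0.
Qed.

Lemma primitive_beyond (R : realType) (f : R -> R) (a : R) :
  continuous f -> exists F : R -> R, forall x, a < x -> is_derive x 1 F (f x).
Proof.
move=> cf.
exists (fun x => \int[lebesgue_measure]_(t in `[a, x]) f t) => x ax.
have xx1 : x < x + 1 by rewrite ltrDl.
have fi : lebesgue_measure.-integrable `[a, x + 1] (EFin \o f).
  apply: continuous_compact_integrable; first exact: segment_compact.
  exact: continuous_subspaceT.
have [df <-] := continuous_FTC1_closed xx1 fi ax (cf x).
by rewrite derive1E; exact: DeriveDef.
Qed.

(** The integral from a is a primitive only to the right of a; primitives based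
    further and further to the left agree after normalisation at x0, and are
    glued. *)
Lemma primitive (R : realType) (f : R -> R) (x0 y0 : R) : continuous f ->
  exists F : R -> R, F x0 = y0 /\ forall x : R, is_derive x 1 F (f x).
Proof.
move=> cf.
have /choice[F HF] : forall n : nat, exists F : R -> R,
    F x0 = y0 /\ forall x, x0 - n.+1%:R < x -> is_derive x 1 F (f x).
  move=> n; have [F HF] := primitive_beyond (x0 - n.+1%:R) cf.
  exists (fun x => F x - (F x0 - y0)); split; first by ring.
  move=> x xn; have := HF x xn => dF.
  by rewrite -[f x]subr0; apply: is_deriveB.
have agree n m x : x0 - n.+1%:R < x -> x0 - m.+1%:R < x -> F n x = F m x.
  move=> xn xm; have [Fn dFn] := HF n; have [Fm dFm] := HF m.
  suff : (F n \- F m) x = (F n \- F m) x0.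
    by rewrite /= Fn Fm subrr => /eqP; rewrite subr_eq0 => /eqP.
  have D z : x0 - n.+1%:R < z -> x0 - m.+1%:R < z ->
      is_derive z 1 (F n \- F m) 0.
    move=> zn zm; rewrite -[X in is_derive _ _ _ X](subrr (f z)).
    by have := dFn z zn; have := dFm z zm => ? ?; apply: is_deriveB.
  have n0 : x0 - n.+1%:R < x0 by rewrite ltrBlDr ltrDl.
  have m0 : x0 - m.+1%:R < x0 by rewrite ltrBlDr ltrDl.
  have [xx0|xx0] := leP x x0; [symmetry|]; apply: derive_zero_constant => //.
  - apply: derivable_within_continuous => z; rewrite in_itv/= => /andP[xz _].
    by apply: (@ex_derive _ _ _ _ _ _ _ (D z (lt_le_trans xn xz) (lt_le_trans xm xz))).
  - by move=> z /andP[xz _]; apply: D; apply: lt_trans xz.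
  - exact: ltW.
  - apply: derivable_within_continuous => z; rewrite in_itv/= => /andP[xz _].
    by apply: (@ex_derive _ _ _ _ _ _ _ (D z (lt_le_trans n0 xz) (lt_le_trans m0 xz))).
  - by move=> z /andP[xz _]; apply: D; apply: lt_trans xz.
pose k x : nat := Num.truncn `|x - x0|.
have kP x : x0 - (k x).+1%:R < x.
  have : `|x - x0| < (k x).+1%:R by exact: truncnS_gt.
  by rewrite ltr_norml => /andP[+ _]; lra.
exists (fun x => F (k x) x); split; first exact: (HF (k x0)).1.
move=> x; have [_ dF] := HF (k x).
have := dF x (kP x); apply: near_eq_is_derive.
near=> z; apply: agree; last exact: kP.
by near: z; apply: lt_nbhsr; exact: kP.
Unshelve. all: by end_near. Qed.

(** The rules are stated for functions given by their values, so that the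
    derivative of an explicit expression is obtained by composing them. *)
Section DerivationRules.
Variable R : realType.
Implicit Types (f g : R -> R) (x d e c : R).

Lemma derive_eq f x d e : is_derive x 1 f d -> d = e -> is_derive x 1 f e.
Proof. by move=> ? <-. Qed.

Lemma derive_add f g x d e : is_derive x 1 f d -> is_derive x 1 g e ->
  is_derive x 1 (fun t => f t + g t) (d + e).
Proof. by move=> df dg; exact: (@is_deriveD _ _ _ f g). Qed.

Lemma derive_sub f g x d e : is_derive x 1 f d -> is_derive x 1 g e ->
  is_derive x 1 (fun t => f t - g t) (d - e).
Proof. by move=> df dg; exact: (@is_deriveB _ _ _ f g). Qed.

Lemma derive_mul f g x d e : is_derive x 1 f d -> is_derive x 1 g e ->
  is_derive x 1 (fun t => f t * g t) (d * g x + f x * e).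
Proof.
move=> df dg; apply: derive_eq (is_deriveM df dg) _.
by rewrite /GRing.scale /=; ring.
Qed.

Lemma derive_const c x : is_derive x 1 (fun=> c) 0.
Proof. exact: is_derive_cst. Qed.

Lemma derive_var x : is_derive x 1 (fun t => t) 1.
Proof. exact: is_derive_id. Qed.

Lemma derive_scale f x d c : is_derive x 1 f d ->
  is_derive x 1 (fun t => c * f t) (c * d).
Proof. by move=> df; exact: (@is_deriveZ _ _ _ f c). Qed.

Lemma derive_comp f g x d e : is_derive (g x) 1 f d -> is_derive x 1 g e ->
  is_derive x 1 (fun t => f (g t)) (d * e).
Proof. by move=> df dg; exact: (@is_derive1_comp _ f g). Qed.

Lemma derive_inv f x d : f x != 0 -> is_derive x 1 f d ->
  is_derive x 1 (fun t => (f t)^-1) (- d / f x ^+ 2).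
Proof.
move=> fx df; apply: derive_eq (is_deriveV fx df) _.
by rewrite [_ *: _]mulrC mulrN mulNr.
Qed.

Lemma derive_sqr f x d : is_derive x 1 f d ->
  is_derive x 1 (fun t => f t ^+ 2) (2 * f x * d).
Proof. by move=> df; apply: derive_eq (derive_mul df df) _; ring. Qed.

End DerivationRules.

(** * The Picard-Lindelof theorem for a pair of unknowns *)

(** One primitive is chosen for every integrand and initial value, so that
    Picard's map is a function that can be iterated. *)
Lemma primitive_operator (R : realType) :
  exists I : (R -> R) -> R -> R -> R, forall f y0, continuous f ->
    I f y0 0 = y0 /\ forall x : R, is_derive x 1 (I f y0) (f x).
Proof.
have /choice[I HI] : forall fy : (R -> R) * R, exists F : R -> R,
    continuous fy.1 -> F 0 = fy.2 /\ forall x : R, is_derive x 1 F (fy.1 x).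
  move=> [f y0] /=; have [cf|ncf] := pselect (continuous f).
    by have [F HF] := primitive 0 y0 cf; exists F.
  by exists f.
by exists (fun f y0 => I (f, y0)) => f y0 cf; exact: (HI (f, y0)).
Qed.

Lemma le_half_pow (R : realType) (a b c : R) :
  (forall k, a <= b + c * 2^-1 ^+ k) -> a <= b.
Proof.
move=> H; apply/ler_addgt0Pr => e e0.
have [k Hk] : exists k : nat, c <= e * 2 ^+ k.
  exists (Num.truncn `|c / e|).+1.
  have : c / e <= (Num.truncn `|c / e|).+1%:R.
    by rewrite (le_trans (ler_norm _))// ltW// truncnS_gt.
  rewrite ler_pdivrMr// mulrC => /le_trans; apply.
  by rewrite ler_pM2l// -natrX ler_nat ltnW// ltn_expl.
rewrite (le_trans (H k))// lerD2l exprVn ler_pdivrMr// exprn_gt0//.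
Qed.

Lemma geometric_limit (R : realType) (u : nat -> R) (C : R) :
  (forall k, `|u k.+1 - u k| <= C * 2^-1 ^+ k) ->
  exists l, forall k, `|l - u k| <= 2 * C * 2^-1 ^+ k.
Proof.
move=> H; pose a k := u k - 2 * C * 2^-1 ^+ k; pose b k := u k + 2 * C * 2^-1 ^+ k.
have C0 k : 0 <= C * 2^-1 ^+ k by apply: le_trans (H k).
have ai : {homo a : m n / (m <= n)%N >-> m <= n}.
  apply: homo_leq => [//|? ? ?|k]; first exact: le_trans.
  have := H k; rewrite /a exprS ler_norml; set c := _ ^+ k => /andP[]; lra.
have bd : {homo b : m n / (m <= n)%N >-> n <= m}.
  apply: homo_leq => [//|? ? ? /[swap]|k]; first exact: le_trans.
  have := H k; rewrite /b exprS ler_norml; set c := _ ^+ k => /andP[]; lra.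
have ab j k : a j <= b k.
  rewrite (le_trans (ai _ _ (leq_maxl j k)))// (le_trans _ (bd _ _ (leq_maxr j k)))//.
  by rewrite /a /b; have := C0 (maxn j k); lra.
exists (sup (range a)) => k.
have hs : has_sup (range a).
  split; first by exists (a 0%N), 0%N.
  by exists (b 0%N) => _ [j _ <-].
have l1 : a k <= sup (range a) by apply: sup_upper_bound => //; exists k.
have l2 : sup (range a) <= b k.
  by apply: sup_le_ub; [exact: hs.1|move=> _ [j _ <-]].
by rewrite ler_norml; move: l1 l2; rewrite /a /b; lra.
Qed.

Lemma lipschitz_continuous (R : realType) (f : R -> R) (M : R) :
  (forall x y, `|f x - f y| <= M * `|x - y|) -> continuous f.
Proof.
move=> H x; apply/cvgrPdist_le => e e0; near=> y.
rewrite (le_trans (H x y))//.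
have M1 : 0 < `|M| + 1 by rewrite ltr_wpDl.
rewrite (@le_trans _ _ ((`|M| + 1) * `|x - y|))//.
  by rewrite ler_wpM2r// (le_trans (ler_norm _))// lerDl.
rewrite mulrC -ler_pdivlMr//.
near: y; apply: cvgr_dist_le; first exact: cvg_id.
by rewrite divr_gt0.
Unshelve. all: by end_near. Qed.

Lemma derive_bounded_lipschitz (R : realType) (f f' : R -> R) (M : R) :
  (forall x : R, is_derive x 1 f (f' x)) -> (forall x, `|f' x| <= M) ->
  forall x y, `|f x - f y| <= M * `|x - y|.
Proof.
move=> df fM x y.
have key a b : a <= b -> `|f b - f a| <= M * (b - a).
  move=> ab; rewrite mulrBr.
  apply: (@norm_increment _ f (fun x => M * x) f' (fun=> M)) => //.
  - by apply: continuous_subspaceT => z; apply: is_derive_continuous (df z).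
  - by apply: continuous_subspaceT => z; apply: cvgM; [exact: cvg_cst|exact: cvg_id].
  - by move=> z _; apply: derive_eq (derive_scale M (derive_var z)) _; ring.
have [xy|/ltW yx] := leP x y.
  by rewrite distrC (ler0_norm (x := x - y)) ?subr_le0// opprB key.
by rewrite (ger0_norm (x := x - y)) ?subr_ge0// key.
Qed.

Lemma is_derive_expRM (R : realType) (c K x : R) :
  is_derive x 1 (fun t => c * expR (K * t)) (c * (K * expR (K * x))).
Proof.
have dE := derive_comp (is_derive_expR _) (derive_scale K (derive_var x)).
by apply: derive_eq (derive_scale c dE) _; ring.
Qed.

(** Integrating a rate bounded by K c exp(K x) gains the factor 1/K. This is why
    Picard's map contracts, on the whole half-line at once, for distances
    measured against exp(K x) with K a multiple of the Lipschitz constant. *)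
Lemma exp_increment (R : realType) (f f' : R -> R) (c K : R) :
  (forall x : R, is_derive x 1 f (f' x)) -> 
  (forall x, 0 <= x -> `|f' x| <= K * c * expR (K * x)) ->
  forall x, 0 <= x -> `|f x - f 0| <= c * (expR (K * x) - 1).
Proof.
move=> df fM x x0.
rewrite mulrBr mulr1 -[X in _ <= _ - X](_ : c * expR (K * 0) = c); last first.
  by rewrite mulr0 expR0 mulr1.
apply: (@norm_increment _ f (fun x => c * expR (K * x)) f'
   (fun x => c * (K * expR (K * x)))) => //.
- by apply: continuous_subspaceT => z; apply: is_derive_continuous (df z).
- by apply: continuous_subspaceT => z; apply: is_derive_continuous (is_derive_expRM _ _ _).
- by move=> z _; exact: is_derive_expRM.
- by move=> z /andP[/ltW z0 _]; rewrite mulrCA mulrA; exact: fM.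
Qed.

(** The fields vanish for negative times. The solutions are then constant there,
    so that they live on the whole line and have a two-sided derivative at time
    0, where the initial values are prescribed. *)
Section Picard.
Variables (R : realType) (f g : R -> R -> R -> R) (M L : R).
Hypothesis L0 : 0 < L.
Hypothesis f0 : forall t x y, t <= 0 -> f t x y = 0.
Hypothesis g0 : forall t x y, t <= 0 -> g t x y = 0.
Hypothesis fM : forall t x y, `|f t x y| <= M.
Hypothesis gM : forall t x y, `|g t x y| <= M.
Hypothesis fL : forall t x y x' y',
  `|f t x y - f t x' y'| <= L * (`|x - x'| + `|y - y'|).
Hypothesis gL : forall t x y x' y',
  `|g t x y - g t x' y'| <= L * (`|x - x'| + `|y - y'|).
Hypothesis fC : forall X Y : R -> R, continuous X -> continuous Y ->
  continuous (fun t => f t (X t) (Y t)).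
Hypothesis gC : forall X Y : R -> R, continuous X -> continuous Y ->
  continuous (fun t => g t (X t) (Y t)).

(** The iterates converge geometrically with weight exp(4 L t), and their
    Lipschitz bound M passes to the limit, which is therefore continuous and a
    fixed point. The same contraction estimate, applied to the iterates of two
    initial values, gives the continuous dependence. *)
Lemma picard_lindelof : exists X Y : R -> R -> R -> R,
  (forall x0 y0, [/\ X x0 y0 0 = x0, Y x0 y0 0 = y0,
    forall t : R, is_derive t 1 (X x0 y0) (f t (X x0 y0 t) (Y x0 y0 t)) &
    forall t : R, is_derive t 1 (Y x0 y0) (g t (X x0 y0 t) (Y x0 y0 t))]) /\
  forall x0 y0 x0' y0' t, 0 <= t ->
    `|X x0 y0 t - X x0' y0' t| + `|Y x0 y0 t - Y x0' y0' t| <=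
      (`|x0 - x0'| + `|y0 - y0'|) * expR (4 * L * t).
Proof.
have [I HI] := primitive_operator R.
pose step x0 y0 (z : (R -> R) * (R -> R)) : (R -> R) * (R -> R) :=
  (I (fun t => f t (z.1 t) (z.2 t)) x0, I (fun t => g t (z.1 t) (z.2 t)) y0).
have stepP x0 y0 (z : (R -> R) * (R -> R)) : continuous z.1 -> continuous z.2 ->
  [/\ (step x0 y0 z).1 0 = x0, (step x0 y0 z).2 0 = y0,
   forall t : R, is_derive t 1 (step x0 y0 z).1 (f t (z.1 t) (z.2 t)) &
   forall t : R, is_derive t 1 (step x0 y0 z).2 (g t (z.1 t) (z.2 t))].
  move=> c1 c2; have [? ?] := HI _ x0 (fC c1 c2); have [? ?] := HI _ y0 (gC c1 c2).
  by split.
(* A function whose rate vanishes for negative times is constant there. *)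
have negc (h h' : R -> R) x : (forall t : R, is_derive t 1 h (h' t)) ->
    (forall t, t <= 0 -> h' t = 0) -> x <= 0 -> h x = h 0.
  move=> dh h0 x0; apply/esym/derive_zero_constant => //.
    by apply: continuous_subspaceT => z; apply: is_derive_continuous (dh z).
  by move=> t /andP[_ /ltW t0]; rewrite -(h0 t t0).
pose K := 4 * L; have K0 : 0 < K by rewrite mulr_gt0.
pose E t := expR (K * t).
have E0 t : 0 < E t by exact: expR_gt0.
have EK t : K * t <= E t.
  by rewrite (le_trans _ (expR_ge1Dx _))// lerDr.
have pos a k t : 0 <= a -> 0 <= a * 2^-1 ^+ k * E t.
  by move=> a0; rewrite mulr_ge0 ?(ltW (E0 t))// mulr_ge0// exprn_ge0.
pose D (z w : (R -> R) * (R -> R)) t := `|z.1 t - w.1 t| + `|z.2 t - w.2 t|.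
(* Each of the two components gains the factor L / K = 1/4, hence the distance D
   the factor 1/2; the difference of the initial values is carried along. *)
have contract x0 y0 x0' y0' z w c : continuous z.1 -> continuous z.2 ->
    continuous w.1 -> continuous w.2 -> 0 <= c ->
    (forall t, 0 <= t -> D z w t <= c * E t) -> forall t, 0 <= t ->
    D (step x0 y0 z) (step x0' y0' w) t <=
      (`|x0 - x0'| + `|y0 - y0'|) + c / 2 * (E t - 1).
  move=> z1 z2 w1 w2 c0 zw t t0.
  have [a1 a2 a3 a4] := stepP x0 y0 z z1 z2.
  have [b1 b2 b3 b4] := stepP x0' y0' w w1 w2.
  have e1 : `|(step x0 y0 z).1 t - (step x0' y0' w).1 t - (x0 - x0')| <= c / 4 * (E t - 1).
    rewrite -{2}a1 -{2}b1.
    apply: (@exp_increment _ (fun t => (step x0 y0 z).1 t - (step x0' y0' w).1 t)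
      (fun t => f t (z.1 t) (z.2 t) - f t (w.1 t) (w.2 t)) _ K _ _ _ t0) => //.
    move=> s s0; rewrite (le_trans (fL _ _ _ _ _))//.
    rewrite (_ : K * _ * _ = L * (c * E s)) ?ler_pM2l//; last by rewrite /E /K; field.
    exact: zw.
  have e2 : `|(step x0 y0 z).2 t - (step x0' y0' w).2 t - (y0 - y0')| <= c / 4 * (E t - 1).
    rewrite -{2}a2 -{2}b2.
    apply: (@exp_increment _ (fun t => (step x0 y0 z).2 t - (step x0' y0' w).2 t)
      (fun t => g t (z.1 t) (z.2 t) - g t (w.1 t) (w.2 t)) _ K _ _ _ t0) => //.
    move=> s s0; rewrite (le_trans (gL _ _ _ _ _))//.
    rewrite (_ : K * _ * _ = L * (c * E s)) ?ler_pM2l//; last by rewrite /E /K; field.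
    exact: zw.
  rewrite /D; move: e1 e2.
  set p := (step x0 y0 z).1 t - _; set q := (step x0 y0 z).2 t - _.
  have := ler_normD (p - (x0 - x0')) (x0 - x0').
  have := ler_normD (q - (y0 - y0')) (y0 - y0').
  rewrite !subrK; lra.
pose z x0 y0 k := iter k (step x0 y0) ((fun=> x0), (fun=> y0)).
have zC x0 y0 k : continuous (z x0 y0 k).1 /\ continuous (z x0 y0 k).2.
  elim: k => [|k [c1 c2]] /=; first by split=> ?; exact: cvg_cst.
  have [_ _ d1 d2] := stepP x0 y0 _ c1 c2.
  by split=> t; [apply: is_derive_continuous (d1 t)|apply: is_derive_continuous (d2 t)].
have zneg x0 y0 k t : t <= 0 -> (z x0 y0 k).1 t = x0 /\ (z x0 y0 k).2 t = y0.
  move=> t0; case: k => [//|k].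
  have [c1 c2] := zC x0 y0 k; have [e1 e2 d1 d2] := stepP x0 y0 _ c1 c2.
  split; rewrite /=.
    by rewrite -[RHS]e1; apply: (negc _ _ _ d1) => // s s0; rewrite f0.
  by rewrite -[RHS]e2; apply: (negc _ _ _ d2) => // s s0; rewrite g0.
have M0 : 0 <= M by apply: le_trans (fM 0 0 0).
(* The first step is at most 2 M t, which is C K t <= C exp(K t). *)
pose C := M / (2 * L).
have C0 : 0 <= C by rewrite divr_ge0// mulr_ge0// ltW.
have zD x0 y0 k t : D (z x0 y0 k.+1) (z x0 y0 k) t <= C * 2^-1 ^+ k * E t.
  have [/ltW t0|t0] := ltP t 0.
    have [e1 e2] := zneg x0 y0 k t t0; have [e3 e4] := zneg x0 y0 k.+1 t t0.
    by rewrite /D e1 e2 e3 e4 !subrr normr0 addr0 pos.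
  elim: k t t0 => [|k IH] t t0.
    have [c1 c2] := zC x0 y0 0%N; have [e1 e2 d1 d2] := stepP x0 y0 _ c1 c2.
    have h1 := derive_bounded_lipschitz d1 (fun s => fM _ _ _) t 0.
    have h2 := derive_bounded_lipschitz d2 (fun s => gM _ _ _) t 0.
    move: h1 h2; rewrite e1 e2 subr0 (ger0_norm t0) /D /= => h1 h2.
    rewrite expr0 mulr1 (le_trans (lerD h1 h2))//.
    rewrite (_ : _ + _ = C * (K * t)); last by rewrite /C /K; field; rewrite gt_eqF.
    by rewrite ler_wpM2l.
  have [c1 c2] := zC x0 y0 k; have [c3 c4] := zC x0 y0 k.+1.
  have c0 : 0 <= C * 2^-1 ^+ k by rewrite mulr_ge0// exprn_ge0.
  have := @contract x0 y0 x0 y0 _ _ _ c3 c4 c1 c2 c0 IH t t0.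
  rewrite !subrr normr0 !add0r => /le_trans; apply.
  rewrite exprS; move: c0; set c := C * _ => c0.
  rewrite (_ : C * _ * E t = c / 2 * E t); last by rewrite /c; field.
  by rewrite ler_wpM2l ?divr_ge0// gerBl.
have /choice[X HX] : forall xyt : R * R * R, exists l, forall k,
    `|l - (z xyt.1.1 xyt.1.2 k).1 xyt.2| <= 2 * (C * E xyt.2) * 2^-1 ^+ k.
  move=> [[x0 y0] t] /=; apply: geometric_limit => k.
  rewrite mulrAC (le_trans _ (zD x0 y0 k t))// lerDl//.
have /choice[Y HY] : forall xyt : R * R * R, exists l, forall k,
    `|l - (z xyt.1.1 xyt.1.2 k).2 xyt.2| <= 2 * (C * E xyt.2) * 2^-1 ^+ k.
  move=> [[x0 y0] t] /=; apply: geometric_limit => k.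
  rewrite mulrAC (le_trans _ (zD x0 y0 k t))// lerDr//.
pose X' x0 y0 t := X (x0, y0, t); pose Y' x0 y0 t := Y (x0, y0, t).
have limX x0 y0 t k : `|X' x0 y0 t - (z x0 y0 k).1 t| <= 2 * (C * E t) * 2^-1 ^+ k.
  exact: (HX (x0, y0, t)).
have limY x0 y0 t k : `|Y' x0 y0 t - (z x0 y0 k).2 t| <= 2 * (C * E t) * 2^-1 ^+ k.
  exact: (HY (x0, y0, t)).
have zLip x0 y0 k s t : `|(z x0 y0 k).1 s - (z x0 y0 k).1 t| <= M * `|s - t| /\
    `|(z x0 y0 k).2 s - (z x0 y0 k).2 t| <= M * `|s - t|.
  case: k => [|k]; first by rewrite /= !subrr normr0 mulr_ge0.
  have [c1 c2] := zC x0 y0 k; have [e1 e2 d1 d2] := stepP x0 y0 _ c1 c2.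
  split; first exact: (derive_bounded_lipschitz d1 (fun s => fM _ _ _)).
  exact: (derive_bounded_lipschitz d2 (fun s => gM _ _ _)).
have tri (a b p q : R) : `|a - b| <= `|a - p| + `|b - q| + `|p - q|.
  by rewrite (le_trans (ler_distD p a b))// -addrA lerD2l addrC (distrC b q) ler_distD.
have X'C x0 y0 : continuous (X' x0 y0).
  apply: (@lipschitz_continuous _ _ M) => s t.
  apply: (@le_half_pow _ _ _ (2 * (C * E s) + 2 * (C * E t))) => k.
  have := tri (X' x0 y0 s) (X' x0 y0 t) ((z x0 y0 k).1 s) ((z x0 y0 k).1 t).
  have := limX x0 y0 s k; have := limX x0 y0 t k; have := (zLip x0 y0 k s t).1.
  rewrite mulrDl; lra.
have Y'C x0 y0 : continuous (Y' x0 y0).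
  apply: (@lipschitz_continuous _ _ M) => s t.
  apply: (@le_half_pow _ _ _ (2 * (C * E s) + 2 * (C * E t))) => k.
  have := tri (Y' x0 y0 s) (Y' x0 y0 t) ((z x0 y0 k).2 s) ((z x0 y0 k).2 t).
  have := limY x0 y0 s k; have := limY x0 y0 t k; have := (zLip x0 y0 k s t).2.
  rewrite mulrDl; lra.
exists X', Y'; split; last first.
  move=> x0 y0 x1 y1 t t0; set d := `|x0 - x1| + _.
  have d0 : 0 <= d by rewrite addr_ge0.
  have iterD k s : 0 <= s -> D (z x0 y0 k) (z x1 y1 k) s <= d * E s.
    elim: k s => [|k IH] s s0.
      by rewrite /D /= -/d ler_peMr// -[leLHS](expR0) ler_expR mulr_ge0// ltW.
    have [c1 c2] := zC x0 y0 k; have [c3 c4] := zC x1 y1 k.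
    rewrite (le_trans (contract x0 y0 x1 y1 _ _ _ c1 c2 c3 c4 d0 IH s s0))// -/d.
    have E1 : 1 <= E s by rewrite -[leLHS](expR0) ler_expR mulr_ge0// ltW.
    have : 0 <= d * (E s - 1) by rewrite mulr_ge0// subr_ge0.
    lra.
  apply: (@le_half_pow _ _ _ (8 * (C * E t))) => k.
  have := iterD k t t0; rewrite /D.
  have := tri (X' x0 y0 t) (X' x1 y1 t) ((z x0 y0 k).1 t) ((z x1 y1 k).1 t).
  have := tri (Y' x0 y0 t) (Y' x1 y1 t) ((z x0 y0 k).2 t) ((z x1 y1 k).2 t).
  have := limX x0 y0 t k; have := limX x1 y1 t k.
  have := limY x0 y0 t k; have := limY x1 y1 t k.
  by rewrite /E /K; lra.
move=> x0 y0.
have [e1 e2 d1 d2] := stepP x0 y0 (X' x0 y0, Y' x0 y0) (X'C _ _) (Y'C _ _).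
pose w := (X' x0 y0, Y' x0 y0).
have fix0 t : D (step x0 y0 w) w t <= 0.
  apply: (@le_half_pow _ _ _ (8 * (C * E t))) => k; rewrite add0r.
  have h : D (step x0 y0 w) (z x0 y0 k.+1) t <= 4 * (C * E t) * 2^-1 ^+ k.
    have [/ltW t0|t0] := ltP t 0.
      have [h1 h2] := zneg x0 y0 k.+1 t t0; rewrite /D h1 h2.
      have -> : (step x0 y0 w).1 t = x0.
        by rewrite -[RHS]e1; apply: (negc _ _ _ d1) => // s s0; rewrite f0.
      have -> : (step x0 y0 w).2 t = y0.
        by rewrite -[RHS]e2; apply: (negc _ _ _ d2) => // s s0; rewrite g0.
      by rewrite !subrr normr0 addr0 mulrA (mulrAC _ (E t)) pos// mulr_ge0.
    have [c1 c2] := zC x0 y0 k.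
    have c0 : 0 <= 4 * C * 2^-1 ^+ k.
      by rewrite mulr_ge0 ?exprn_ge0// mulr_ge0.
    have wz s : 0 <= s -> D w (z x0 y0 k) s <= 4 * C * 2^-1 ^+ k * E s.
      move=> _; rewrite /D; have := limX x0 y0 s k; have := limY x0 y0 s k.
      rewrite /w /=; lra.
    have := @contract x0 y0 x0 y0 w _ _ (X'C _ _) (Y'C _ _) c1 c2 c0 wz t t0.
    rewrite !subrr normr0 !add0r => /le_trans; apply.
    have : 0 <= 4 * C * 2^-1 ^+ k * E t by rewrite mulr_ge0// ltW.
    lra.
  move: h; rewrite /D.
  have := limX x0 y0 t k.+1; have := limY x0 y0 t k.+1.
  have := ler_distD ((z x0 y0 k.+1).1 t) ((step x0 y0 w).1 t) (X' x0 y0 t).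
  have := ler_distD ((z x0 y0 k.+1).2 t) ((step x0 y0 w).2 t) (Y' x0 y0 t).
  have -> : 2 * (C * E t) * 2^-1 ^+ k.+1 = C * E t * 2^-1 ^+ k by rewrite exprS; field.
  rewrite ![`|X' _ _ _ - _|]distrC ![`|Y' _ _ _ - _|]distrC /w /=.
  have : 0 <= C * E t * 2^-1 ^+ k by rewrite mulrAC pos.
  lra.
have fixX : (step x0 y0 w).1 = X' x0 y0.
  apply/funext => t; apply/eqP; rewrite -subr_eq0 -normr_le0.
  by apply: le_trans (fix0 t); rewrite /D lerDl.
have fixY : (step x0 y0 w).2 = Y' x0 y0.
  apply/funext => t; apply/eqP; rewrite -subr_eq0 -normr_le0.
  by apply: le_trans (fix0 t); rewrite /D lerDr.
by move: e1 e2 d1 d2; rewrite -/w fixX fixY.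
Qed.

End Picard.

(** * Retractions, the fundamental theorem of calculus, smooth bumps *)

Lemma continuous_retraction (T U : topologicalType) (A : set T) (r : T -> T)
    (f : T -> U) :
  continuous r -> (forall x, A (r x)) -> {within A, continuous f} ->
  continuous (f \o r).
Proof.
move=> cr Ar /subspace_continuousP cf x; apply: cvg_comp (cf _ (Ar x)).
move=> B wB; change (nbhs x (r @^-1` B)).
have : nbhs x (r @^-1` [set z | A z -> B z]) by exact: (cr x _ wB).
by apply: filterS => y; apply; exact: Ar.
Qed.

(** Composing with clamp extends a function on [a, b] by constants, keeping its
    continuity and its Lipschitz constant. *)
Definition clamp (R : realType) (a b x : R) : R := Num.max a (Num.min x b).

Lemma clamp_itv (R : realType) (a b x : R) : a <= b -> a <= clamp a b x <= b.
Proof.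
by move=> ab; rewrite /clamp le_max lexx/= ge_max ab/= ge_min lexx orbT.
Qed.

Lemma clamp_id (R : realType) (a b x : R) : a <= x <= b -> clamp a b x = x.
Proof. by move=> /andP[ax xb]; rewrite /clamp min_l// max_r. Qed.

Lemma clamp_continuous (R : realType) (a b : R) : continuous (clamp a b).
Proof.
move=> x; apply: (@continuous_max _ _ (cst a) (fun x => Num.min x b)).
  exact: cvg_cst.
by apply: (@continuous_min _ _ id (cst b)); [exact: cvg_id|exact: cvg_cst].
Qed.

Lemma continuous_clamp (R : realType) (a b : R) (f : R -> R) : a <= b ->
  {within `[a, b], continuous f} -> continuous (f \o clamp a b).
Proof.
move=> ab; apply: continuous_retraction; first exact: clamp_continuous.
by move=> x /=; rewrite in_itv/= clamp_itv.
Qed.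

Lemma integral_FTC (R : realType) (f F : R -> R) (a b : R) : a < b ->
  {within `[a, b], continuous f} -> {within `[a, b], continuous F} ->
  (forall x, a < x < b -> is_derive x 1 F (f x)) ->
  (\int[lebesgue_measure]_(x in `]a, b[) (f x)%:E = (F b - F a)%:E)%E.
Proof.
move=> ab cf /(continuous_within_itvP _ ab)[_ Fa Fb] dF.
have ii : lebesgue_measure.-integrable `[a, b] (EFin \o f).
  by apply: continuous_compact_integrable => //; exact: segment_compact.
have mab : measurable_fun `[a, b] f.
  by case/integrableP: ii => /measurable_EFinP.
rewrite -(@integral_itv_bndoo _ a b _ true false)//; last first.
  apply/measurable_EFinP; apply: measurable_funS mab => //.
  exact: subset_itv_oo_cc.
rewrite (@continuous_FTC2 _ f F a b ab cf)//.
- split=> // x; rewrite in_itv/= => /dF dx; exact: ex_derive.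
- by move=> x; rewrite in_itv/= => /dF dx; rewrite derive1E derive_val.
Qed.

Lemma Rintegral_FTC (R : realType) (f F : R -> R) (a b : R) : a < b ->
  {within `[a, b], continuous f} -> {within `[a, b], continuous F} ->
  (forall x, a < x < b -> is_derive x 1 F (f x)) ->
  \int[lebesgue_measure]_(x in `]a, b[) f x = F b - F a.
Proof. by move=> ab cf cF dF; rewrite /Rintegral (integral_FTC ab cf cF dF). Qed.

Lemma derive_clamp (R : realType) (f : R -> R) (a b x d : R) : a < x < b ->
  is_derive x 1 f d -> is_derive x 1 (f \o clamp a b) d.
Proof.
move=> /andP[ax xb]; apply: near_eq_is_derive; near=> t.
rewrite /= clamp_id//; apply/andP; split; apply: ltW; near: t.
  exact: lt_nbhsr.
exact: lt_nbhsl.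
Unshelve. all: by end_near. Qed.

Section Flat.
Variable R : realType.

(** The derivative of P(1/x) exp(-1/x), extended by 0 to x <= 0, is a function of
    the same form: P ranges over all polynomials so that the family is closed
    under derivation. *)
Definition flat (P : {poly R}) (x : R) : R :=
  if 0 < x then P.[x^-1] * expR (- x^-1) else 0.

Lemma pow_le_expR (n : nat) (y : R) : 0 <= y -> y ^+ n <= n`!%:R * expR y.
Proof.
case: n => [|n] y0; first by rewrite mul1r expr0 -expR0 ler_expR.
have := expR_ge1Dxn n y0; set e := expR y => H.
have : y ^+ n.+1 / n.+1`!%:R <= e by apply: le_trans H; rewrite lerDr.
by rewrite ler_pdivrMr ?ltr0n ?fact_gt0// mulrC.
Qed.

Lemma poly_le_expR (P : {poly R}) :
  exists C : R, forall y, 0 <= y -> `|P.[y]| <= C * expR y.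
Proof.
exists (\sum_(i < size P) `|P`_i| * i`!%:R) => y y0.
rewrite horner_coef (le_trans (ler_norm_sum _ _ _))// mulr_suml.
apply: ler_sum => i _; rewrite normrM -mulrA ler_wpM2l//.
by rewrite normrX (ger0_norm y0) pow_le_expR.
Qed.

(** At 0, exp(-1/x) beats every power of 1/x, so flat P is O(x^2). *)
Lemma derive_flat (P : {poly R}) (x : R) :
  is_derive x 1 (flat P) (flat ('X^2 * (P - P^`())) x).
Proof.
have [x0|x0|->] := ltgtP x 0.
- rewrite {2}/flat ltNge (ltW x0)/=.
  apply: near_eq_is_derive (derive_const 0 x).
  near=> z; rewrite /flat ltNge (_ : z <= 0)//.
  by apply: ltW; near: z; apply: lt_nbhsl.
- have xn0 : x != 0 by rewrite gt_eqF.
  rewrite {2}/flat x0.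
  have dinv : is_derive x 1 (fun t => t^-1) (- 1 / x ^+ 2).
    exact: (derive_inv xn0 (derive_var x)).
  have dP : is_derive x^-1 1 (horner P) (P^`()).[x^-1] by exact: is_derive_poly.
  have d1 := derive_comp dP dinv.
  have d2 := derive_comp (is_derive_expR _) (derive_scale (-1) dinv).
  apply: near_eq_is_derive; last first.
    apply: derive_eq (derive_mul d1 d2) _.
    rewrite !hornerE /= mulN1r; field.
    by [].
  near=> z; rewrite /flat mulN1r (_ : 0 < z)//.
  by near: z; exact: lt_nbhsr.
- rewrite {2}/flat ltxx.
  have [C HC] := poly_le_expR ('X^2 * P).
  have C0 : 0 <= C.
    by have := HC 0 (lexx _); rewrite expR0 mulr1; apply: le_trans.
  have bd t : `|flat P t| <= C * t ^+ 2.
    rewrite /flat; case: ifP => t0; last by rewrite normr0 mulr_ge0// sqr_ge0.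
    have ti : 0 <= t^-1 by rewrite invr_ge0 ltW.
    have H := HC _ ti; rewrite !hornerE normrM (ger0_norm (sqr_ge0 _)) in H.
    rewrite normrM (ger0_norm (expR_ge0 _)) expRN ler_pdivrMr ?expR_gt0//.
    rewrite (_ : C * _ * _ = C * expR t^-1 * t ^+ 2); last by ring.
    rewrite (_ : `|_| = t^-1 ^+ 2 * `|P.[t^-1]| * t ^+ 2).
      by rewrite ler_wpM2r ?sqr_ge0.
    by field; rewrite gt_eqF.
  apply/is_derive1_caratheodory; exists (fun z => flat P z / z); split.
  + move=> z; rewrite [flat P 0]/flat ltxx !subr0.
    have [->|z0] := eqVneq z 0; first by rewrite /flat ltxx !mulr0.
    by rewrite divfK.
  + move=> /=; apply/cvgrPdist_le => e e0.
    have C1 : 0 < C + 1 by lra.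
    near=> z; rewrite invr0 mulr0 sub0r normrN normrM normfV.
    have [->|z0] := eqVneq z 0; first by rewrite normr0 invr0 mulr0 ltW.
    rewrite ler_pdivrMr ?normr_gt0// (le_trans (bd z))//.
    rewrite -real_normK ?num_real// expr2 mulrA ler_wpM2r//.
    rewrite (@le_trans _ _ ((C + 1) * `|z|))//.
      by rewrite ler_wpM2r// lerDl.
    rewrite mulrC -ler_pdivlMr// -[z]subr0 distrC.
    near: z; apply: cvgr_dist_le; first exact: cvg_id.
    by rewrite divr_gt0.
  + by rewrite invr0 mulr0.
Unshelve. all: by end_near. Qed.

(** A set of functions stable under derivation consists of smooth functions; this
    replaces any computation of higher derivatives. *)
Inductive flat_algebra : (R -> R) -> Prop :=
| flat_affine P c d : flat_algebra (fun x => flat P (c + d * x))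
| flat_add f g : flat_algebra f -> flat_algebra g ->
    flat_algebra (fun x => f x + g x)
| flat_mul f g : flat_algebra f -> flat_algebra g ->
    flat_algebra (fun x => f x * g x)
| flat_scale c f : flat_algebra f -> flat_algebra (fun x => c * f x).

Lemma flat_algebra_derive f : flat_algebra f ->
  exists2 g, flat_algebra g & forall x : R, is_derive x 1 f (g x).
Proof.
elim=> {f} [P c d|f g Af [f' Af' df] Ag [g' Ag' dg]|
    f g Af [f' Af' df] Ag [g' Ag' dg]|c f Af [f' Af' df]].
- exists (fun x => d * flat ('X^2 * (P - P^`())) (c + d * x)).
    exact/flat_scale/flat_affine.
  move=> x; have da := derive_add (derive_const c x) (derive_scale d (derive_var x)).
  by apply: derive_eq (derive_comp (derive_flat _ _) da) _; ring.
- exists (fun x => f' x + g' x); first exact: flat_add.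
  by move=> x; exact: derive_add.
- exists (fun x => f' x * g x + f x * g' x).
    by apply: flat_add; exact: flat_mul.
  by move=> x; exact: derive_mul.
- by exists (fun x => c * f' x); [exact: flat_scale|move=> x; exact: derive_scale].
Qed.

Lemma flat_algebra_smooth f n : flat_algebra f ->
  forall x : R, derivable (derive1n n f) x 1.
Proof.
move=> Af; suff [g Ag ->] : exists2 g, flat_algebra g & derive1n n f = g.
  by have [g' _ dg] := flat_algebra_derive Ag => x; exact: ex_derive.
elim: n => [|n [g Ag E]]; first by exists f.
have [g' Ag' dg] := flat_algebra_derive Ag.
exists g' => //; rewrite derive1nS E; apply/funext => x.
by rewrite derive1E derive_val.
Qed.

Definition flat_bump (e x : R) : R := flat 1 x * flat 1 (e - x).

Lemma flat_bump_algebra e a c : flat_algebra (fun x => c * flat_bump e (x - a)).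
Proof.
apply: flat_scale; rewrite [X in flat_algebra X](_ : _ =
   fun x => flat 1 (- a + 1 * x) * flat 1 (e + a + (- 1) * x)).
  by apply: flat_mul; exact: flat_affine.
apply/funext => x; rewrite /flat_bump; congr (flat _ _ * flat _ _); ring.
Qed.

Lemma flat1_ge0 x : 0 <= flat 1 x.
Proof.
by rewrite /flat; case: ifP => // _; rewrite hornerE mul1r expR_ge0.
Qed.

Lemma flat1_gt0 x : 0 < x -> 0 < flat 1 x.
Proof. by move=> x0; rewrite /flat x0 hornerE mul1r expR_gt0. Qed.

Lemma flat_bump_ge0 e x : 0 <= flat_bump e x.
Proof. by rewrite mulr_ge0// flat1_ge0. Qed.

Lemma flat_bump_gt0 e x : 0 < x < e -> 0 < flat_bump e x.
Proof. by move=> /andP[? ?]; rewrite mulr_gt0// flat1_gt0// subr_gt0. Qed.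

Lemma flat_bump_out e x : ~~ (0 < x < e) -> flat_bump e x = 0.
Proof.
rewrite /flat_bump /flat subr_gt0; case: (0 < x) => /=; last by rewrite mul0r.
by move=> /negbTE ->; rewrite mulr0.
Qed.

Lemma flat_bump_continuous e : continuous (flat_bump e).
Proof.
have [g _ dg] := flat_algebra_derive (flat_bump_algebra e 0 1).
have -> : flat_bump e = fun x => 1 * flat_bump e (x - 0).
  by apply/funext => x; rewrite mul1r subr0.
by move=> x; exact: is_derive_continuous (dg x).
Qed.

End Flat.

(** * A continuous function with a continuous weak derivative is differentiable *)

Lemma flat_bump_primitive (R : realType) (e : R) : 0 < e ->
  exists B : R -> R, [/\ forall x : R, is_derive x 1 B (flat_bump e x),
    forall x, x <= 0 -> B x = 0, forall x, e <= x -> B x = B e & 0 < B e].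
Proof.
move=> e0; have [B [B0 dB]] := primitive 0 0 (@flat_bump_continuous R e).
have cB := fun x => is_derive_continuous (dB x).
exists B; split=> //.
- move=> x x0; rewrite -B0; apply/esym/derive_zero_constant => //.
    exact: continuous_subspaceT.
  move=> t /andP[_ t0]; rewrite -(@flat_bump_out R e t)//.
  by rewrite negb_and -leNgt ltW.
- move=> x xe; apply: derive_zero_constant => //.
    exact: continuous_subspaceT.
  move=> t /andP[te _]; rewrite -(@flat_bump_out R e t)//.
  by rewrite negb_and -!leNgt orbC ltW.
- have [|c] := @MVT _ B (flat_bump e) 0 e e0 (fun x _ => dB x).
    exact: continuous_subspaceT.
  by rewrite in_itv/= B0 !subr0 => ce ->; rewrite mulr_gt0// flat_bump_gt0.
Qed.

Lemma continuous_near_right (R : realType) (h : R -> R) (x d : R) :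
  {for x, continuous h} -> 0 < d ->
  exists2 e, 0 < e & forall e', e' <= e ->
    forall t, x < t < x + e' -> `|h t - h x| <= d.
Proof.
move=> /cvgrPdist_le /(_ _ _)/[apply] H.
have [e /= e0 He] := H; exists e => // e' ee t /andP[xt te].
rewrite distrC; apply: He => /=; rewrite ltr0_norm ?subr_lt0//.
rewrite opprB ltrBlDl (lt_le_trans te)// lerD2l//.
Qed.

Lemma Rintegral_I0pi (R : realType) (f g G : R -> R) : continuous g ->
  (forall x, 0 < x < pi -> f x = g x) -> (forall x : R, is_derive x 1 G (g x)) ->
  \int[lebesgue_measure]_(x in I0pi) f x = G pi - G 0.
Proof.
move=> cg fg dG; rewrite -(@Rintegral_FTC _ g G _ _ (@pi_gt0 R))//.
- by apply: eq_Rintegral => x; rewrite inE /I0pi/= in_itv/=; exact: fg.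
- exact: continuous_subspaceT.
- by apply: continuous_subspaceT => x; exact: is_derive_continuous (dG x).
Qed.

(** The lemma of du Bois-Reymond. Let G be a primitive of g and h = f - G, so that
    h has weak derivative 0. If h x2 < h x1, take for test function P the
    difference of two translates of the primitive of a bump of width e: it has
    compact support, and P' is a bump on the right of x1 minus the same bump on
    the right of x2. As h is nearly constant on both bumps, the integral of h P'
    is about (h x1 - h x2) times the mass of the bump, which contradicts that it
    is 0. Hence h is constant. *)
Lemma weak_derivative_classical (R : realType) (f g : R -> R) :
  {within `[0, pi], continuous f} -> {within `[0, pi], continuous g} ->
  weak_derivative_0pi f g ->
  forall x, 0 < x < pi -> is_derive x 1 f (g x).
Proof.
move=> cf cg wfg; have pi0 := @pi_gt0 R.
have cfc := continuous_clamp (ltW pi0) cf; have cgc := continuous_clamp (ltW pi0) cg.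
have [G [_ dG]] := primitive 0 0 cgc.
have cG : continuous G by move=> x; apply: is_derive_continuous (dG x).
pose h x := f (clamp 0 pi x) - G x.
have ch : continuous h by move=> x; apply: cvgB; [exact: cfc|exact: cG].
have key (x1 x2 : R) : 0 < x1 < pi -> 0 < x2 < pi -> h x1 <= h x2.
  move=> /andP[x10 x1p] /andP[x20 x2p]; rewrite leNgt; apply/negP => h12.
  pose d := (h x1 - h x2) / 4.
  have d0 : 0 < d by rewrite divr_gt0// subr_gt0.
  have [e1 e10 H1] := continuous_near_right (ch x1) d0.
  have [e2 e20 H2] := continuous_near_right (ch x2) d0.
  pose e := Num.min (Num.min e1 e2) (Num.min ((pi - x1) / 2) ((pi - x2) / 2)).
  have e0 : 0 < e by rewrite !lt_min e10 e20 !divr_gt0 ?subr_gt0.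
  have ee1 : e <= e1 by rewrite !ge_min lexx.
  have ee2 : e <= e2 by rewrite !ge_min lexx ?orbT.
  have ep1 : e <= (pi - x1) / 2 by rewrite !ge_min lexx ?orbT.
  have ep2 : e <= (pi - x2) / 2 by rewrite !ge_min lexx ?orbT.
  have [B [dB Bl Br Be]] := flat_bump_primitive e0.
  pose b t := flat_bump e (t - x1) - flat_bump e (t - x2).
  pose P t := B (t - x1) - B (t - x2).
  have dBx (a t : R) : is_derive t 1 (fun t => B (t - a)) (flat_bump e (t - a)).
    have := @derive_comp _ B (fun t => t - a) _ _ _ (dB _)
      (derive_sub (derive_var t) (derive_const a t)).
    by move/derive_eq; apply; ring.
  have dP (t : R) : is_derive t 1 P (b t) by exact: derive_sub.
  have cb : continuous b.
    move=> t; apply: cvgB.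
      by apply: (@continuous_comp _ _ _ (fun t => t - x1) (flat_bump e));
        [apply: cvgB; [exact: cvg_id|exact: cvg_cst]|exact: flat_bump_continuous].
    by apply: (@continuous_comp _ _ _ (fun t => t - x2) (flat_bump e));
      [apply: cvgB; [exact: cvg_id|exact: cvg_cst]|exact: flat_bump_continuous].
  have cP : continuous P by move=> t; apply: is_derive_continuous (dP t).
  have P'E : derive1 P = b by apply/funext => t; rewrite derive1E derive_val.
  have bA : flat_algebra b.
    rewrite [X in flat_algebra X](_ : _ = fun t =>
      1 * flat_bump e (t - x1) + (-1) * flat_bump e (t - x2)).
      by apply: flat_add; exact: flat_bump_algebra.
    by apply/funext => t; rewrite mul1r mulN1r.
  have PC : Cc_infty_0pi P.
    split.
      case=> [|n] t; first exact: ex_derive.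
      by rewrite /derive1n iterSr P'E; exact: flat_algebra_smooth.
    exists (Num.min x1 x2), (Num.max x1 x2 + e); split.
    - by rewrite lt_min x10.
    - rewrite -ltrBrDr gt_max; apply/andP; split; lra.
    - move=> t /negP; rewrite negb_and -!ltNge lt_min => /orP[/andP[t1 t2]|].
        by rewrite /P !Bl ?subrr// subr_le0 ltW.
      rewrite -ltrBrDr gt_max => /andP[t1 t2].
      by rewrite /P Br ?(Br (t - x2)) ?subrr//; lra.
  have P0 : P 0 = 0 by rewrite /P !Bl ?subrr// subr_le0 ltW.
  have Ppi : P pi = 0 by rewrite /P Br ?(Br (pi - x2)) ?subrr//; lra.
  have cfb : continuous (fun t => f (clamp 0 pi t) * b t).
    by move=> t; apply: cvgM; [exact: cfc|exact: cb].
  have cgP : continuous (fun t => g (clamp 0 pi t) * P t).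
    by move=> t; apply: cvgM; [exact: cgc|exact: cP].
  have [F1 [_ dF1]] := primitive 0 0 cfb.
  have [F2 [_ dF2]] := primitive 0 0 cgP.
  have cF1 : continuous F1 by move=> t; apply: is_derive_continuous (dF1 t).
  have cF2 : continuous F2 by move=> t; apply: is_derive_continuous (dF2 t).
  have := wfg P PC; rewrite P'E.
  rewrite (@Rintegral_I0pi _ _ (fun t => f (clamp 0 pi t) * b t) F1)//; last first.
    by move=> t t0p; rewrite clamp_id//; case/andP: t0p => /ltW -> /ltW ->.
  rewrite (@Rintegral_I0pi _ _ (fun t => g (clamp 0 pi t) * P t) F2)//; last first.
    by move=> t t0p; rewrite clamp_id//; case/andP: t0p => /ltW -> /ltW ->.
  move=> F12.
  pose K t := F1 t + F2 t - G t * P t.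
  have dK (t : R) : is_derive t 1 K (h t * b t).
    have := derive_sub (derive_add (dF1 t) (dF2 t)) (derive_mul (dG t) (dP t)).
    by move/derive_eq; apply; rewrite /h /=; ring.
  have cK : continuous K by move=> t; apply: is_derive_continuous (dK t).
  have KE : K pi - K 0 = 0 by rewrite /K P0 Ppi; lra.
  (* J' is a lower bound of h b, as h > h x1 - d on the first bump and
     h < h x2 + d on the second. *)
  pose J t := (h x1 - d) * B (t - x1) - (h x2 + d) * B (t - x2).
  have dJ (t : R) : is_derive t 1 J
      ((h x1 - d) * flat_bump e (t - x1) - (h x2 + d) * flat_bump e (t - x2)).
    by apply: derive_sub; exact: derive_scale.
  have cJ : continuous J by move=> t; apply: is_derive_continuous (dJ t).
  have JK : J pi - J 0 <= K pi - K 0.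
    apply: (@le_increment _ _ _ _ _ _ _ (ltW pi0) _ _ (fun x _ => dJ x) (fun x _ => dK x)).
    - exact: continuous_subspaceT.
    - exact: continuous_subspaceT.
    - move=> t _; rewrite /b mulrBr; apply: lerB.
        have [t1|/flat_bump_out ->] := boolP (0 < t - x1 < e); last by rewrite !mulr0.
        rewrite ler_wpM2r ?flat_bump_ge0//.
        have : x1 < t < x1 + e by lra.
        by move=> /(H1 _ ee1); rewrite ler_norml => /andP[]; lra.
      have [t1|/flat_bump_out ->] := boolP (0 < t - x2 < e); last by rewrite !mulr0.
      rewrite ler_wpM2r ?flat_bump_ge0//.
      have : x2 < t < x2 + e by lra.
      by move=> /(H2 _ ee2); rewrite ler_norml => /andP[]; lra.
  move: JK; rewrite KE /J.
  rewrite (Bl (0 - x1)) ?(Bl (0 - x2)); [|lra..].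
  rewrite (Br (pi - x1)) ?(Br (pi - x2)); [|lra..].
  rewrite !mulr0 !subrr subr0 -mulrBl leNgt pmulr_lgt0//.
  by rewrite /d; lra.
move=> x /andP[x0 xp]; have pi2 : 0 < (pi / 2 : R) < pi by lra.
apply: (@near_eq_is_derive _ _ _ (fun t => G t + h (pi / 2))); last first.
  have := derive_add (dG x) (derive_const (h (pi / 2)) x).
  by move/derive_eq; apply; rewrite addr0 /= clamp_id ?ltW.
near=> t.
have tp : 0 < t < pi.
  apply/andP; split; near: t; [exact: lt_nbhsr|exact: lt_nbhsl].
have -> : h (pi / 2) = h t by apply: le_anti; rewrite !key.
by case/andP: tp => /ltW t0 /ltW tp; rewrite /h clamp_id ?t0// addrC subrK.
Unshelve. all: by end_near. Qed.

(** * Signed powers and the sublinear nonlinearity *)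

Section SignedPowers.
Variable R : realType.
Implicit Types (a t U v : R).

Lemma norm_powR_continuous_neq0 a t : t != 0 ->
  {for t, continuous (fun s : R => `|s| `^ a)}.
Proof.
move=> t0; have n0 : 0 < `|t| by rewrite normr_gt0.
have cn : {for t, continuous (fun s : R => `|s|)} by exact: norm_continuous.
have cp : {for `|t|, continuous (fun s : R => s `^ a)}.
  exact: is_derive_continuous (is_derive1_powR a n0).
exact: (continuous_comp cn cp).
Qed.

Lemma norm_powR_small a e : 0 < a -> 0 < e ->
  \forall t \near (0 : R), `|t| `^ a <= e.
Proof.
move=> a0 e0; near=> t.
have -> : e = (e `^ a^-1) `^ a by rewrite -powRrM mulVf ?gt_eqF// powRr1 ?ltW.
apply: ge0_ler_powR; rewrite ?nnegrE ?powR_ge0 ?(ltW a0)//.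
rewrite -[t]subr0 distrC.
near: t; apply: cvgr_dist_le; first exact: cvg_id.
exact: powR_gt0.
Unshelve. all: by end_near. Qed.

Lemma norm_powR_continuous a : 0 < a -> continuous (fun s : R => `|s| `^ a).
Proof.
move=> a0 t; have [->|] := eqVneq t 0; last exact: norm_powR_continuous_neq0.
apply/cvgrPdist_le => e e0; near=> s.
rewrite normr0 powR0 ?gt_eqF// sub0r normrN ger0_norm ?powR_ge0//.
by near: s; exact: norm_powR_small.
Unshelve. all: by end_near. Qed.

(** At 0 the difference quotient is |t|^a, which tends to 0. *)
Lemma derive_signed_power a U : 0 < a ->
  is_derive U 1 (fun t : R => t * `|t| `^ a) ((1 + a) * `|U| `^ a).
Proof.
move=> a0.
have pos t : 0 < t ->
    is_derive t 1 (fun t : R => t * `|t| `^ a) ((1 + a) * `|t| `^ a).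
  move=> t0; apply: (@near_eq_is_derive _ _ _ (fun s : R => s * s `^ a)).
    near=> s; rewrite gtr0_norm//.
    by near: s; exact: lt_nbhsr.
  apply: derive_eq (derive_mul (derive_var t) (is_derive1_powR a t0)) _.
  by rewrite gtr0_norm// mulrCA mulr_powRB1 ?ltW//; ring.
have [U0|U0|->] := ltgtP U 0; last first.
- apply/is_derive1_caratheodory; exists (fun t => `|t| `^ a); split.
  + by move=> z; rewrite !mul0r !subr0 mulrC.
  + exact: norm_powR_continuous.
  + by rewrite normr0 powR0 ?gt_eqF// mulr0.
- exact: pos.
- have NU0 : 0 < - U by rewrite oppr_gt0.
  have dN : is_derive U 1 (fun t : R => - t) (- 1).
    exact: (@is_deriveN _ _ _ id).
  rewrite [X in is_derive _ _ X](_ : _ =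
     fun t : R => (-1) * ((- t) * `|- t| `^ a)); last first.
    by apply/funext => t; rewrite normrN mulN1r mulNr opprK.
  have := derive_scale (-1) (@derive_comp _ _ _ _ _ _ (pos _ NU0) dN).
  by move/derive_eq; apply; rewrite normrN; ring.
Unshelve. all: by end_near. Qed.

Definition sublinear (p v : R) : R := `|v| `^ (p - 1) * v.

Lemma sublinear_continuous p : 0 < p -> continuous (sublinear p).
Proof.
move=> p0 v; have [->|v0] := eqVneq v 0.
  apply/cvgrPdist_le => e e0; near=> s.
  rewrite /sublinear mulr0 sub0r normrN normrM.
  rewrite (ger0_norm (powR_ge0 _ _)) mulrC mulr_powRB1//.
  by near: s; exact: norm_powR_small.
by apply: cvgM; [exact: norm_powR_continuous_neq0|exact: cvg_id].
Unshelve. all: by end_near. Qed.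

Lemma sublinear_comp_continuous p (u : R -> R) : 0 < p -> continuous u ->
  continuous (fun x => sublinear p (u x)).
Proof.
move=> p0 cu x; have cs := @sublinear_continuous p p0 (u x).
exact: (continuous_comp (cu x) cs).
Qed.

(** The exponent gam is the one for which, with u = U|U|^gam, the product of
    |u|^(p-1) u and |U|^gam is linear in U: this removes the singularity of the
    nonlinearity at 0. *)
Lemma sublinear_signed_power p U : 0 < p < 1 ->
  let gam := (1 - p) / (1 + p) in
  sublinear p (U * `|U| `^ gam) * `|U| `^ gam = U.
Proof.
move=> /andP[p0 p1] gam; have [->|U0] := eqVneq U 0.
  by rewrite /sublinear mul0r mulr0 mul0r.
have n0 : `|U| != 0 by rewrite normr_eq0.
rewrite /sublinear normrM (ger0_norm (powR_ge0 _ _)).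
have -> : `|U| * `|U| `^ gam = `|U| `^ (1 + gam).
  by rewrite powRD ?powRr1// n0 implybT.
rewrite -powRrM.
rewrite (_ : _ * _ * _ = U * (`|U| `^ ((1 + gam) * (p - 1)) *
  (`|U| `^ gam * `|U| `^ gam))); last by ring.
rewrite -!powRD ?n0 ?implybT//.
rewrite (_ : _ * _ + (_ + _) = 0) ?powRr0 ?mulr1//.
by rewrite /gam; field; lra.
Qed.

End SignedPowers.

(** * Bounded Lipschitz fields *)

Section Admissible.
Variable R : realType.
Implicit Types (h k : R -> R -> R -> R) (a : R -> R).

(** What Picard's theorem asks of a field (t, x, m) |-> h t x m, in a form that is
    inherited by sums, products and inverses, so that it is checked along the
    expression defining the field. *)
Definition admissible h : Prop :=
  [/\ exists M, forall t x m, `|h t x m| <= M,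
      exists L, forall t x m x' m',
        `|h t x m - h t x' m'| <= L * (`|x - x'| + `|m - m'|) &
      forall X Y : R -> R, continuous X -> continuous Y ->
        continuous (fun t => h t (X t) (Y t))].

Lemma admissible_time a M : continuous a -> (forall t, `|a t| <= M) ->
  admissible (fun t _ _ => a t).
Proof.
move=> ca aM; split=> //; first by exists M.
by exists 0 => *; rewrite subrr normr0 mul0r.
Qed.

Lemma admissible_const c : admissible (fun _ _ _ => c).
Proof.
by apply: (@admissible_time (cst c) `|c|) => // t; exact: cvg_cst.
Qed.

Lemma admissible_x a M L : continuous a -> (forall x, `|a x| <= M) ->
  0 <= L -> (forall x y, `|a x - a y| <= L * `|x - y|) ->
  admissible (fun _ x _ => a x).
Proof.
move=> ca aM L0 aL; split; [by exists M| |].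
  exists L => t x m x' m'; rewrite (le_trans (aL _ _))// ler_wpM2l//.
  by rewrite lerDl.
by move=> X Y cX _ t; apply: continuous_comp; [exact: cX|exact: ca].
Qed.

Lemma admissible_m a M L : continuous a -> (forall x, `|a x| <= M) ->
  0 <= L -> (forall x y, `|a x - a y| <= L * `|x - y|) ->
  admissible (fun _ _ m => a m).
Proof.
move=> ca aM L0 aL; split; [by exists M| |].
  exists L => t x m x' m'; rewrite (le_trans (aL _ _))// ler_wpM2l//.
  by rewrite lerDr.
by move=> X Y _ cY t; apply: continuous_comp; [exact: cY|exact: ca].
Qed.

Lemma admissible_add h k : admissible h -> admissible k ->
  admissible (fun t x m => h t x m + k t x m).
Proof.
move=> [[M hM] [L hL] hc] [[N kN] [P kP] kc]; split.
- by exists (M + N) => t x m; rewrite (le_trans (ler_normD _ _))// lerD.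
- exists (L + P) => t x m x' m'.
  rewrite opprD addrACA mulrDl (le_trans (ler_normD _ _))// lerD//.
- by move=> X Y cX cY t; apply: cvgD; [exact: hc|exact: kc].
Qed.

Lemma admissible_mul h k : admissible h -> admissible k ->
  admissible (fun t x m => h t x m * k t x m).
Proof.
move=> [[M hM] [L hL] hc] [[N kN] [P kP] kc]; split.
- by exists (M * N) => t x m; rewrite normrM ler_pM.
- exists (M * P + L * N) => t x m x' m'; set d := `|x - x'| + _.
  have := ler_normD (h t x m * (k t x m - k t x' m'))
                    ((h t x m - h t x' m') * k t x' m').
  rewrite !normrM (_ : _ + _ * k t x' m' =
    h t x m * k t x m - h t x' m' * k t x' m'); last by ring.
  move=> /le_trans; apply; rewrite (_ : _ * d = M * (P * d) + L * d * N); last by ring.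
  by rewrite lerD// ler_pM// ?hL ?kP.
- by move=> X Y cX cY t; apply: cvgM; [exact: hc|exact: kc].
Qed.

Lemma admissible_inv h c : 0 < c -> (forall t x m, c <= h t x m) ->
  admissible h -> admissible (fun t x m => (h t x m)^-1).
Proof.
move=> c0 ch [_ [L hL] hc].
have h0 t x m : 0 < h t x m by apply: lt_le_trans (ch t x m).
have hV t x m : (h t x m)^-1 <= c^-1 by rewrite lef_pV2 ?posrE.
split.
- by exists c^-1 => t x m; rewrite ger0_norm ?hV// invr_ge0 ltW.
- exists (c^-1 * c^-1 * L) => t x m x' m'.
  rewrite (_ : _ - _ = (h t x m)^-1 * (h t x' m')^-1 * (h t x' m' - h t x m)); last first.
    by field; rewrite !gt_eqF.
  rewrite normrM -(mulrA (c^-1 * c^-1)) ler_pM//.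
    rewrite ger0_norm ?mulr_ge0 ?invr_ge0 ?(ltW (h0 _ _ _))//.
    by apply: ler_pM; rewrite ?hV ?invr_ge0 ?(ltW (h0 _ _ _)).
  by rewrite distrC hL.
- move=> X Y cX cY t; apply: cvgV; first by rewrite gt_eqF.
  exact: hc.
Qed.

End Admissible.

Lemma clamp_lipschitz (R : realType) (a b x y : R) :
  `|clamp a b x - clamp a b y| <= `|x - y|.
Proof.
have key (s t : R) : s <= t -> 0 <= clamp a b t - clamp a b s <= t - s.
  rewrite /clamp => st; rewrite /Num.max /Num.min.
  by case: (ltP t b); case: (ltP s b) => ? ?; case: ltP => ?; case: ltP => ?; lra.
have [xy|/ltW yx] := leP x y.
  have /andP[k0 k1] := key _ _ xy.
  by rewrite distrC ger0_norm// distrC ger0_norm// subr_ge0.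
have /andP[k0 k1] := key _ _ yx.
by rewrite ger0_norm// ger0_norm// subr_ge0.
Qed.

Lemma expR_lipschitz (R : realType) (a b : R) : a <= 0 -> b <= 0 ->
  `|expR a - expR b| <= `|a - b|.
Proof.
have key (s t : R) : s <= t -> t <= 0 -> 0 <= expR t - expR s <= t - s.
  move=> st t0; rewrite subr_ge0 ler_expR st/=.
  rewrite (_ : expR s = expR t * expR (s - t)); last by rewrite -expRD addrC subrK.
  have := expR_ge1Dx (s - t); have : expR t <= 1 by rewrite -expR0 ler_expR.
  have := expR_gt0 t; set u := expR t; set v := expR _; nra.
move=> a0 b0; have [xy|/ltW yx] := leP a b.
  have /andP[k0 k1] := key _ _ xy b0.
  by rewrite distrC ger0_norm// distrC ger0_norm// subr_ge0.
have /andP[k0 k1] := key _ _ yx a0.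
by rewrite ger0_norm// ger0_norm// subr_ge0.
Qed.

(** * Inverting a change of variable *)

Lemma increasing_inverse (R : realType) (X : R -> R) (a b : R) : a < b ->
  continuous X -> (forall s t, a <= s -> s < t -> X s < X t) ->
  exists th : R -> R, [/\ continuous th,
    (forall x, a <= th x <= b),
    (forall t, a <= t <= b -> th (X t) = t) &
    (forall x, X a <= x <= X b -> X (th x) = x)].
Proof.
move=> ab cX iX; have XaXb : X a < X b by exact: iX.
have /choice[g gP] : forall x, exists t,
    X a <= x <= X b -> a <= t <= b /\ X t = x.
  move=> x; have [/andP[ax xb]|] := boolP (X a <= x <= X b); last by exists a.
  have [||t tab Xt] := @IVT _ X a b x (ltW ab).
  - exact: continuous_subspaceT.
  - by rewrite ge_min ax/= le_max xb orbT.
  - by exists t => _; move: tab; rewrite in_itv.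
have gK t : a <= t <= b -> g (X t) = t.
  move=> /andP[t0 tb].
  have XI : X a <= X t <= X b.
    apply/andP; split.
      by move: t0; rewrite le_eqVlt => /predU1P[<-//|t0]; apply/ltW/iX.
    by move: tb; rewrite le_eqVlt => /predU1P[->//|tb]; apply/ltW/iX.
  have [/andP[h1 h2] h] := gP _ XI.
  have [lt|lt|//] := ltgtP (g (X t)) t.
    by have := iX _ _ h1 lt; rewrite h ltxx.
  by have := iX _ _ t0 lt; rewrite h ltxx.
have cg : {within `[X a, X b], continuous g}.
  have gKab : {in `[a, b], cancel X g} by move=> t; rewrite in_itv; exact: gK.
  exact: segment_can_le_continuous (ltW ab) (continuous_subspaceT cX) gKab.
exists (g \o clamp (X a) (X b)); split.
- by apply: continuous_clamp => //; exact: ltW.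
- by move=> x; have [] := gP _ (clamp_itv x (ltW XaXb)).
- move=> t tab; rewrite /= clamp_id; first exact: gK.
  case/andP: tab => t0 tb; apply/andP; split.
    by move: t0; rewrite le_eqVlt => /predU1P[<-//|t0]; apply/ltW/iX.
  by move: tb; rewrite le_eqVlt => /predU1P[->//|tb]; apply/ltW/iX.
- by move=> x xI; rewrite /= clamp_id//; have [] := gP _ xI.
Qed.

(** If V has the rate g (X t) X' t, then V t and the primitive of g at X t have
    the same derivative. There is no division by X', which may vanish; this
    happens at the zeros of the solutions constructed below. *)
Lemma derive_reparametrized (R : realType) (X X' V g th : R -> R) (a b : R) :
  a <= b -> continuous X -> continuous V -> continuous g ->
  (forall t : R, a < t < b -> is_derive t 1 X (X' t)) ->
  (forall t : R, a < t < b -> is_derive t 1 V (g (X t) * X' t)) ->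
  (forall x, a <= th x <= b) ->
  (forall x, X a <= x <= X b -> X (th x) = x) ->
  forall x, X a < x < X b -> is_derive x 1 (V \o th) (g x).
Proof.
move=> ab cX cV cg dX dV thI thK x /andP[xa xb].
have [P [P0 dP]] := primitive (X a) (V a) cg.
have cP : continuous P by move=> z; apply: is_derive_continuous (dP z).
have VP t : a <= t <= b -> V t = P (X t).
  move=> /andP[ta tb]; apply/eqP; rewrite -subr_eq0.
  rewrite -(subrr (V a)) -[in X in _ == _ - X]P0; apply/eqP.
  apply: (@derive_zero_constant _ (fun t => V t - P (X t)) a t ta).
    apply: continuous_subspaceT => z; apply: cvgB; first exact: cV.
    by apply: continuous_comp; [exact: cX|exact: cP].
  move=> z /andP[za zt].
  have zI : a < z < b by rewrite za (lt_le_trans zt).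
  by apply: derive_eq (derive_sub (dV z zI) (derive_comp (dP _) (dX z zI))) _; ring.
apply: near_eq_is_derive (dP x); near=> y.
rewrite /= VP// thK//; apply/andP; split; apply: ltW; near: y.
  exact: lt_nbhsr.
exact: lt_nbhsl.
Unshelve. all: by end_near. Qed.

(** * Small solutions of the Dirichlet problem by shooting *)

Lemma is_derive_unique (R : realType) (f : R -> R) (x d e : R) :
  is_derive x 1 f d -> is_derive x 1 f e -> d = e.
Proof. by move=> [_ <-] [_ <-]. Qed.

(** With w = rho u' and u = U|U|^gam, the equation becomes, for the independent
    variable s such that dx/ds = |U|^gam,
      dU/ds = kap w / rho,   dw/ds = - rho U (1 + mu |U|^(2 gam)).
    In polar coordinates U = R sin t, w = R cos t, the angle t increases at the
    rate speed, which is close to kap cos^2 t / rho + rho sin^2 t for R small.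
    Taking t as independent variable, x and m = gam ln R satisfy a system whose
    right-hand sides xfield and mfield depend on t through |sin t|^gam, but are
    Lipschitz in (x, m). The factor R^gam = exp m is truncated at exp m1, which
    keeps speed positive; it is undone for solutions of small amplitude. *)
Section Shooting.
Variables (R : realType) (p mu : R) (rho drho : R -> R) (beta K rho0 : R).
Hypothesis hp : 0 < p < 1.
Hypothesis rho0_gt0 : 0 < rho0.
Hypothesis rho_bd : forall x, 0 <= x <= pi -> rho0 <= rho x <= beta.
Hypothesis rho_cont : {within `[0, pi], continuous rho}.
Hypothesis rho_derive : forall x, 0 < x < pi -> is_derive x 1 rho (drho x).
Hypothesis drho_bd : forall x, 0 < x < pi -> `|drho x| <= K.

Let gam : R := (1 - p) / (1 + p).
Let kap : R := (p + 1) / 2.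
Let m1 : R := - (`|mu| + 1).
Definition weight (x : R) : R := rho (clamp 0 pi x).
Local Notation r := weight.
(** Sine and cosine are frozen for negative angles: there sn = 0, so that both
    fields vanish, as Picard's theorem above wants. *)
Definition sn (t : R) : R := sin (Num.max t 0).
Definition cs (t : R) : R := cos (Num.max t 0).
(** This is |U|^gam / R^gam. *)
Definition zn (t : R) : R := `|sn t| `^ gam.
(** This is R^gam, truncated. *)
Definition tau (m : R) : R := expR (Num.min m m1).
Definition perturb (t m : R) : R := 1 + mu * (tau m ^+ 2 * zn t ^+ 2).
Definition speed (t x m : R) : R :=
  kap * cs t ^+ 2 / r x + r x * sn t ^+ 2 * perturb t m.
Definition xfield (t x m : R) : R := tau m * zn t / speed t x m.
Definition mfield (t x m : R) : R :=
  gam * (sn t * cs t) * (kap / r x - r x * perturb t m) / speed t x m.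

Let p0 : 0 < p. Proof. by case/andP: hp. Qed.
Let p1 : p < 1. Proof. by case/andP: hp. Qed.
Lemma gam_gt0 : 0 < gam.
Proof. by have [p_0 p_1] := (p0, p1); apply: divr_gt0; lra. Qed.
Lemma gam_lt1 : gam < 1.
Proof. by have [p_0 p_1] := (p0, p1); rewrite ltr_pdivrMr; lra. Qed.
Let kap_gt0 : 0 < kap.
Proof. by have p_0 := p0; apply: divr_gt0; lra. Qed.
Let pi0 : 0 < pi :> R. Proof. exact: pi_gt0. Qed.

Let r_bd x : rho0 <= r x <= beta.
Proof. by apply: rho_bd; apply: clamp_itv; exact: pi_ge0. Qed.
Let r_gt0 x : 0 < r x.
Proof. by case/andP: (r_bd x) => + _; exact: lt_le_trans. Qed.
Let r_neq0 x : r x != 0. Proof. by rewrite gt_eqF. Qed.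
Let beta_gt0 : 0 < beta.
Proof.
by have /andP[h1 h2] := r_bd 0; apply: lt_le_trans rho0_gt0 (le_trans h1 h2).
Qed.
Let K_ge0 : 0 <= K.
Proof.
have /drho_bd : 0 < (pi / 2 : R) < pi by have := pi0; lra.
exact: le_trans.
Qed.

Lemma weight_continuous : continuous r.
Proof. by apply: continuous_clamp => //; exact: pi_ge0. Qed.

Lemma weight_derive x : 0 < x < pi -> is_derive x 1 r (drho x).
Proof. by move=> xI; apply: derive_clamp (rho_derive xI). Qed.

Let weight_lipschitz x y : `|r x - r y| <= K * `|x - y|.
Proof.
have key (s t : R) : 0 <= s -> s <= t -> t <= pi -> `|rho t - rho s| <= K * (t - s).
  move=> s0 st tp; rewrite mulrBr.
  apply: (@norm_increment _ rho (fun x => K * x) drho (fun=> K)) => //.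
  - apply: continuous_subspaceW rho_cont => z /=; rewrite !in_itv/= => /andP[? ?].
    by apply/andP; split; lra.
  - by apply: continuous_subspaceT => z; apply: cvgM; [exact: cvg_cst|exact: cvg_id].
  - by move=> z /andP[? ?]; apply: rho_derive; lra.
  - by move=> z _; apply: derive_eq (derive_scale K (derive_var z)) _; ring.
  - by move=> z /andP[? ?]; apply: drho_bd; lra.
have cl (x' : R) : 0 <= clamp 0 pi x' <= pi by apply: clamp_itv; exact: pi_ge0.
rewrite (@le_trans _ _ (K * `|clamp 0 pi x - clamp 0 pi y|))//; last first.
  by rewrite ler_wpM2l// clamp_lipschitz.
rewrite /weight; have /andP[] := cl x; have /andP[] := cl y.
move: (clamp 0 pi x) (clamp 0 pi y) => u v v0 vp u0 up.
have [uv|/ltW vu] := leP u v.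
  by rewrite distrC (distrC u) (ger0_norm (x := v - u)) ?subr_ge0// key.
by rewrite (ger0_norm (x := u - v)) ?subr_ge0// key.
Qed.

Let max0_continuous : continuous (fun t : R => Num.max t 0).
Proof.
move=> t; apply: (@continuous_max _ _ id (cst 0)); first exact: cvg_id.
exact: cvg_cst.
Qed.
Lemma sn_continuous : continuous sn.
Proof. by move=> t; apply: continuous_comp; [exact: max0_continuous|exact: continuous_sin]. Qed.
Lemma cs_continuous : continuous cs.
Proof. by move=> t; apply: continuous_comp; [exact: max0_continuous|exact: continuous_cos]. Qed.
Let zn_continuous : continuous zn.
Proof.
move=> t; apply: (@continuous_comp _ _ _ sn (fun s => `|s| `^ gam)).
  exact: sn_continuous.
exact: (norm_powR_continuous gam_gt0).
Qed.

Let cs2sn2 t : cs t ^+ 2 + sn t ^+ 2 = 1. Proof. exact: cos2Dsin2. Qed.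
Let sn_norm t : `|sn t| <= 1. Proof. exact: sin_max. Qed.
Let cs_norm t : `|cs t| <= 1. Proof. exact: cos_max. Qed.
Let zn_ge0 t : 0 <= zn t. Proof. exact: powR_ge0. Qed.
Let zn_le1 t : zn t <= 1.
Proof.
rewrite (_ : 1 = 1 `^ gam); last by rewrite powR1.
apply: ge0_ler_powR; rewrite ?nnegrE//.
exact/ltW/gam_gt0.
Qed.
Let zn_ge_sqr t : sn t ^+ 2 <= zn t.
Proof.
have [s0|s0] := eqVneq (sn t) 0; first by rewrite s0 expr0n.
rewrite -(real_normK (num_real _)) -powR_mulrn// ger_powR//.
  by rewrite normr_gt0 s0 sn_norm.
by have := gam_lt1; lra.
Qed.

Let m1_le0 : m1 <= 0. Proof. by rewrite /m1 oppr_le0 addr_ge0. Qed.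
Let tau_gt0 m : 0 < tau m. Proof. exact: expR_gt0. Qed.
Let tau_le1 m : tau m <= 1.
Proof. by rewrite -expR0 ler_expR ge_min m1_le0 orbT. Qed.
Let tau_mu m : `|mu| * tau m ^+ 2 <= 2^-1.
Proof.
have h : tau m <= expR m1 by rewrite ler_expR ge_min lexx orbT.
have h2 : expR m1 * (1 + (`|mu| + 1)) <= 1.
  rewrite /m1 expRN mulrC ler_pdivrMr ?expR_gt0// mul1r; exact: expR_ge1Dx.
have := tau_gt0 m; have := normr_ge0 mu; move: h h2.
set a := tau m; set b := expR m1; set c := `|mu| => ab bc c0 a0.
have ac : a * (2 + c) <= 1 by nra.
nra.
Qed.

(** The choice of m1 makes |mu| tau^2 at most 1/2, whatever the sign of mu. *)
Let perturb_bd t m : 2^-1 <= perturb t m <= 3 / 2.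
Proof.
have : `|mu * (tau m ^+ 2 * zn t ^+ 2)| <= 2^-1.
  rewrite mulrA normrM (ger0_norm (sqr_ge0 (zn t))) normrM.
  rewrite (ger0_norm (sqr_ge0 (tau m))).
  have z1 : zn t ^+ 2 <= 1 by rewrite expr_le1.
  have := tau_mu m; set a := _ * tau m ^+ 2 => a1.
  have a0 : 0 <= a by rewrite mulr_ge0// sqr_ge0.
  have := sqr_ge0 (zn t); nra.
by rewrite ler_norml /perturb => /andP[]; lra.
Qed.

Let sp0 := Num.min (kap / beta) (rho0 / 2).
Let sp1 := kap / rho0 + beta * (3 / 2).
Let sp0_gt0 : 0 < sp0.
Proof. by rewrite lt_min; apply/andP; split; exact: divr_gt0. Qed.
Let speed_bd t x m : sp0 <= speed t x m <= sp1.
Proof.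
have /andP[r0 r1] := r_bd x; have /andP[n0 n1] := perturb_bd t m.
have c0 := sqr_ge0 (cs t); have s0 := sqr_ge0 (sn t); have cs1 := cs2sn2 t.
have k1 : kap / beta <= kap / r x by rewrite ler_pM2l// lef_pV2 ?posrE.
have k2 : kap / r x <= kap / rho0 by rewrite ler_pM2l// lef_pV2 ?posrE.
have q1 : rho0 / 2 <= r x * perturb t m by apply: ler_pM => //; exact: ltW.
have q2 : r x * perturb t m <= beta * (3 / 2).
  by apply: ler_pM => //; [exact: ltW|apply: le_trans n0].
have -> : speed t x m = kap / r x * cs t ^+ 2 + r x * perturb t m * sn t ^+ 2.
  by rewrite /speed; ring.
have m1' : sp0 <= kap / r x by rewrite (le_trans _ k1)// ge_min lexx.
have m2' : sp0 <= r x * perturb t m by rewrite (le_trans _ q1)// ge_min lexx orbT.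
have kr0 : 0 <= kap / rho0 by rewrite divr_ge0// ltW.
have br0 : 0 <= beta * (3 / 2) by rewrite mulr_ge0// ltW.
move: m1' m2' k2 q2 kr0 br0; rewrite /sp1.
set A := kap / r x; set B := r x * _; set a := kap / rho0; set b := beta * _.
move: c0 s0 cs1; set u := cs t ^+ 2; set v := sn t ^+ 2 => c0 s0 cs1 *.
have vu : v = 1 - u by lra.
apply/andP; split; nra.
Qed.
Let speed_gt0 t x m : 0 < speed t x m.
Proof. by case/andP: (speed_bd t x m) => + _; exact: lt_le_trans. Qed.

Let adm_weight : admissible (fun _ x _ : R => r x).
Proof.
apply: (@admissible_x _ _ beta K) => //; first exact: weight_continuous.
by move=> x; rewrite gtr0_norm//; case/andP: (r_bd x).
Qed.
Let adm_weightV : admissible (fun _ x _ : R => (r x)^-1).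
Proof.
apply: (@admissible_inv _ (fun _ x _ => r x) rho0) => //.
by move=> _ x _; case/andP: (r_bd x).
Qed.
Let adm_tau : admissible (fun _ _ m : R => tau m).
Proof.
apply: (@admissible_m _ _ 1 1) => //.
- move=> t; apply: continuous_comp; last exact: continuous_expR.
  by apply: (@continuous_min _ _ id (cst m1)); [exact: cvg_id|exact: cvg_cst].
- by move=> x; rewrite gtr0_norm.
- move=> x y; rewrite mul1r (le_trans (expR_lipschitz _ _)) ?ge_min ?m1_le0 ?orbT//.
  rewrite !minEle; case: (leP x m1); case: (leP y m1) => xm ym //.
  + rewrite !ler0_norm; lra.
  + rewrite !ger0_norm; lra.
  + by rewrite subrr normr0.
Qed.
Let adm_sn : admissible (fun t _ _ : R => sn t).
Proof. by apply: (@admissible_time _ _ 1) => //; exact: sn_continuous. Qed.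
Let adm_cs : admissible (fun t _ _ : R => cs t).
Proof. by apply: (@admissible_time _ _ 1) => //; exact: cs_continuous. Qed.
Let adm_zn : admissible (fun t _ _ : R => zn t).
Proof. by apply: (@admissible_time _ _ 1) => // t; rewrite ger0_norm. Qed.
Let adm_perturb : admissible (fun t _ m : R => perturb t m).
Proof.
apply: admissible_add; first exact: admissible_const.
apply: admissible_mul; first exact: admissible_const.
by apply: admissible_mul; apply: admissible_mul.
Qed.
Let adm_speedV : admissible (fun t x m : R => (speed t x m)^-1).
Proof.
apply: (@admissible_inv _ speed sp0) => //.
  by move=> t x m; case/andP: (speed_bd t x m).
apply: admissible_add.
  apply: admissible_mul => //; apply: admissible_mul; first exact: admissible_const.
  exact: admissible_mul.
by apply: admissible_mul => //; apply: admissible_mul => //; apply: admissible_mul.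
Qed.
Let adm_xfield : admissible xfield.
Proof. by apply: admissible_mul => //; apply: admissible_mul. Qed.
Let adm_mfield : admissible mfield.
Proof.
apply: admissible_mul => //; apply: admissible_mul.
  apply: admissible_mul; first exact: admissible_const.
  exact: admissible_mul.
rewrite [X in admissible X](_ : _ = fun t x m : R =>
  kap * (r x)^-1 + (-1) * (r x * perturb t m)); last first.
  by apply/funext => t; apply/funext => x; apply/funext => m; rewrite mulN1r.
apply: admissible_add.
  by apply: admissible_mul => //; exact: admissible_const.
by apply: admissible_mul; [exact: admissible_const|exact: admissible_mul].
Qed.

Definition trajectory (m0 : R) (X Y : R -> R) : Prop :=
  [/\ X 0 = 0, Y 0 = m0,
      forall t : R, is_derive t 1 X (xfield t (X t) (Y t)) &
      forall t : R, is_derive t 1 Y (mfield t (X t) (Y t))].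

Lemma trajectories_exist : exists X Y : R -> R -> R,
  (forall m0, trajectory m0 (X m0) (Y m0)) /\
  forall t, 0 <= t -> continuous (fun m0 => X m0 t).
Proof.
have [[M1 f1] [L1 f2] f3] := adm_xfield.
have [[M2 g1] [L2 g2] g3] := adm_mfield.
pose M := Num.max M1 M2; pose L := Num.max 1 (Num.max L1 L2).
have L0 : 0 < L by rewrite lt_max ltr01.
have sn0 t : t <= 0 -> sn t = 0 by move=> t0; rewrite /sn max_r// sin0.
have [||||||X [Y [XY cXY]]] := @picard_lindelof R xfield mfield M L L0 _ _ _ _ _ _ f3 g3.
- move=> t x y t0; rewrite /xfield /zn sn0// normr0 powR0 ?mulr0 ?mul0r//.
  by rewrite gt_eqF// gam_gt0.
- by move=> t x y t0; rewrite /mfield sn0// mul0r mulr0 !mul0r.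
- by move=> t x y; rewrite (le_trans (f1 _ _ _))// le_max lexx.
- by move=> t x y; rewrite (le_trans (g1 _ _ _))// le_max lexx orbT.
- move=> t x y x' y'; rewrite (le_trans (f2 _ _ _ _ _))// ler_wpM2r ?addr_ge0//.
  by rewrite !le_max lexx orbT.
- move=> t x y x' y'; rewrite (le_trans (g2 _ _ _ _ _))// ler_wpM2r ?addr_ge0//.
  by rewrite !le_max lexx !orbT.
exists (X 0), (Y 0); split; first exact: XY.
move=> t t0; apply: (@lipschitz_continuous _ _ (expR (4 * L * t))) => m m'.
have := cXY 0 m 0 m' t t0; rewrite subrr normr0 add0r mulrC => h.
by rewrite (le_trans _ h)// lerDl.
Qed.

Let e0 := Num.min kap (rho0 ^+ 2).
Let e1 := kap + beta ^+ 2.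
Let e0_gt0 : 0 < e0. Proof. by rewrite lt_min kap_gt0 exprn_gt0. Qed.
Let Cq := (2 * beta * K + 2 * kap * beta * `|mu|) / e0.
Let apriori_bound := gam / 2 * (Cq * pi + 2 * (`|ln e0| + `|ln e1|)).
Section OneTrajectory.
Variables (m0 : R) (X Y : R -> R).
Hypothesis XY : trajectory m0 X Y.

Lemma traj_continuous : continuous X /\ continuous Y.
Proof.
have [_ _ dX dY] := XY.
by split=> t; [exact: is_derive_continuous (dX t)|exact: is_derive_continuous (dY t)].
Qed.

Let xfield_ge0 t x m : 0 <= xfield t x m.
Proof. by rewrite divr_ge0// ?mulr_ge0// ltW. Qed.

Lemma traj_nondecreasing s t : s <= t -> X s <= X t.
Proof.
move=> st; have [_ _ dX _] := XY; have [cX _] := traj_continuous.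
rewrite -subr_ge0 -[leLHS](subrr (0 : R)).
apply: (@le_increment _ (fun=> 0) X (fun=> 0) (fun t => xfield t (X t) (Y t))) => //.
- by move=> z; apply: cvg_cst.
- exact: continuous_subspaceT.
Qed.

(** X is nondecreasing; if it took the same value twice, xfield and hence sin
    would vanish on an interval. *)
Lemma traj_increasing s t : 0 <= s -> s < t -> X s < X t.
Proof.
move=> s0 st; rewrite lt_neqAle traj_nondecreasing ?(ltW st)// andbT.
apply/negP => /eqP E; have [_ _ dX _] := XY.
have z0 q : s < q < t -> sin q = 0.
  move=> /andP[sq qt]; have q0 : 0 < q by apply: le_lt_trans sq.
  have dc : is_derive q 1 X 0.
    apply: near_eq_is_derive (derive_const (X s) q); near=> u.
    apply: le_anti; apply/andP; split; [|rewrite E]; apply: traj_nondecreasing; apply: ltW.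
      by near: u; exact: lt_nbhsr.
    by near: u; exact: lt_nbhsl.
  have := is_derive_unique (dX q) dc.
  move/eqP; rewrite /xfield !mulf_eq0 invr_eq0 (gt_eqF (tau_gt0 _)).
  rewrite (gt_eqF (speed_gt0 _ _ _)) orbF /= powR_eq0 normr_eq0 /sn max_l ?(ltW q0)//.
  by case/andP => /eqP.
pose q := (s + t) / 2.
have sqt : s < q < t by rewrite /q; lra.
have [sq qt] := andP sqt.
have cq : cos q = 0.
  apply: is_derive_unique (is_derive_sin q) _.
  apply: near_eq_is_derive (derive_const 0 q); near=> u.
  rewrite z0//; apply/andP; split; near: u; [exact: lt_nbhsr|exact: lt_nbhsl].
by have := cos2Dsin2 q; rewrite cq z0// expr0n addr0 => /esym/eqP; rewrite oner_eq0.
Unshelve. all: by end_near. Qed.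


Lemma sn_derive (t : R) : 0 < t -> is_derive t 1 sn (cs t).
Proof.
move=> t0; rewrite /cs max_l ?ltW//.
apply: near_eq_is_derive (is_derive_sin t); near=> u.
by rewrite /sn max_l//; apply: ltW; near: u; exact: lt_nbhsr.
Unshelve. all: by end_near. Qed.

Lemma cs_derive (t : R) : 0 < t -> is_derive t 1 cs (- sn t).
Proof.
move=> t0; rewrite /sn max_l ?ltW//.
apply: near_eq_is_derive (is_derive_cos t); near=> u.
by rewrite /cs max_l//; apply: ltW; near: u; exact: lt_nbhsr.
Unshelve. all: by end_near. Qed.

(** The energy kap w^2 + rho^2 U^2 is R^2 nrm, and Qf is its logarithm. Along a
    trajectory its leading terms cancel: what remains of its rate, that is
    Qf_derive, contains rho' or mu and is proportional to dX/dt. *)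
Let nrm t := kap * cs t ^+ 2 + r (X t) ^+ 2 * sn t ^+ 2.
Let nrm_bd t : e0 <= nrm t <= e1.
Proof.
have /andP[r0 r1] := r_bd (X t).
have c0 := sqr_ge0 (cs t); have s0 := sqr_ge0 (sn t); have cs1 := cs2sn2 t.
have k0 := ltW kap_gt0.
have q1 : rho0 ^+ 2 <= r (X t) ^+ 2 by rewrite ler_sqr ?nnegrE// ltW.
have q2 : r (X t) ^+ 2 <= beta ^+ 2 by rewrite ler_sqr ?nnegrE// ltW.
have m1' : e0 <= kap by rewrite ge_min lexx.
have m2' : e0 <= r (X t) ^+ 2 by rewrite (le_trans _ q1)// ge_min lexx orbT.
have b0 := sqr_ge0 beta.
move: m1' m2' q2 b0 k0 c0 s0 cs1; rewrite /nrm /e1.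
set u := cs t ^+ 2; set v := sn t ^+ 2; set B := r _ ^+ 2; set b := beta ^+ 2.
move=> *; have vu : v = 1 - u by lra.
apply/andP; split; nra.
Qed.
Let nrm_gt0 t : 0 < nrm t.
Proof. by case/andP: (nrm_bd t) => + _; exact: lt_le_trans. Qed.

Let Qf t := 2 / gam * Y t + ln (nrm t).

Let Qrate t := (2 * r (X t) * drho (X t) * sn t ^+ 2
  - 2 * kap * r (X t) * sn t * cs t * mu * tau (Y t) * zn t) / nrm t.

Let Qf_derive (t : R) : 0 < t -> 0 < X t < pi ->
  is_derive t 1 Qf (xfield t (X t) (Y t) * Qrate t).
Proof.
move=> t0 Xt; rewrite /Qrate; have [_ _ dX dY] := XY.
have drX := derive_comp (weight_derive Xt) (dX t).
have dn := derive_add (derive_scale kap (derive_sqr (cs_derive t0)))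
                      (derive_mul (derive_sqr drX) (derive_sqr (sn_derive t0))).
have dln := derive_comp (is_derive1_ln (nrm_gt0 t)) dn.
have := derive_add (derive_scale (2 / gam) (dY t)) dln.
move/derive_eq; apply.
rewrite /mfield /xfield.
have g0 : gam != 0 by rewrite gt_eqF// gam_gt0.
have n0 : nrm t != 0 by rewrite gt_eqF.
have sp0' : speed t (X t) (Y t) != 0 by rewrite gt_eqF.
have rX0 := r_neq0 (X t).
set rX := r (X t) in drX dn dln rX0 *; set T := speed _ _ _ in sp0' *.
set N := perturb t (Y t); set m := nrm t in n0 *.
set f := tau (Y t) * zn t; set c := cs t; set s := sn t.
(* The cancellation: the derivative of ln R and that of nrm add up to a multiple
   of N - 1 = mu f^2, thanks to cos^2 + sin^2 = 1. *)
have key : (kap / rX - rX * N) * m + (rX ^+ 2 - kap) * T =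
           - kap * rX * mu * f ^+ 2.
  rewrite (_ : T = kap * c ^+ 2 / rX + rX * s ^+ 2 * N)//.
  rewrite (_ : m = kap * c ^+ 2 + rX ^+ 2 * s ^+ 2)//.
  transitivity (kap * rX * (1 - N) * (c ^+ 2 + s ^+ 2)); first by field.
  by rewrite cs2sn2 /N /perturb /f; ring.
transitivity (2 * s * c * (((kap / rX - rX * N) * m + (rX ^+ 2 - kap) * T) / (T * m))
   + 2 * rX * drho (X t) * (f / T) * s ^+ 2 / m).
  by rewrite -/m; field; rewrite n0 sp0' rX0.
by rewrite key /f; field; rewrite n0 sp0'.
Qed.

Let Qf_rate (t : R) : 0 < X t < pi -> `|Qrate t| <= Cq.
Proof.
rewrite /Qrate; set x := X t => xI; rewrite normrM normfV (gtr0_norm (nrm_gt0 t)).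
have /andP[r0 r1] := r_bd x; have r0' := ltW (r_gt0 x).
have /andP[n0 _] := nrm_bd t.
apply: ler_pM => //; first by rewrite invr_ge0 ltW.
  rewrite (le_trans (ler_normB _ _))// lerD//.
    rewrite 3!normrM normr_nat (ger0_norm r0') (ger0_norm (sqr_ge0 _)).
    have d0 := drho_bd xI.
    have s1 : sn t ^+ 2 <= 1 by have := cs2sn2 t; have := sqr_ge0 (cs t); lra.
    rewrite -[leRHS]mulr1; apply: ler_pM => //; first by rewrite !mulr_ge0.
      exact: sqr_ge0.
    by apply: ler_pM; rewrite ?mulr_ge0// ler_pM2l.
  rewrite 7!normrM normr_nat (ger0_norm r0') (gtr0_norm kap_gt0).
  rewrite (gtr0_norm (tau_gt0 _)) (ger0_norm (zn_ge0 _)).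
  have k0 := ltW kap_gt0.
  have sc : `|sn t| * `|cs t| <= 1 by rewrite mulr_ile1.
  have tz : tau (Y t) * zn t <= 1 by rewrite mulr_ile1// ltW.
  rewrite [leLHS](_ : _ = (2 * kap) * (r x * `|mu| *
     ((`|sn t| * `|cs t|) * (tau (Y t) * zn t)))); last by ring.
  have k2 : 0 <= 2 * kap by exact: mulr_ge0.
  rewrite -(mulrA (2 * kap)); apply: ler_wpM2l => //.
  rewrite -[leRHS]mulr1; apply: ler_pM.
  - exact: mulr_ge0.
  - by apply: mulr_ge0; apply: mulr_ge0 => //; exact: ltW.
  - exact: ler_wpM2r.
  - by apply: mulr_ile1 => //; apply: mulr_ge0 => //; exact: ltW.
by rewrite lef_pV2 ?posrE.
Qed.

(** As |dQf/dt| <= Cq dX/dt, the energy varies by a bounded factor while x runs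
    through [0, pi], however many turns this takes. So does R. *)
Lemma traj_apriori t : 0 <= t -> X t <= pi -> `|Y t - m0| <= apriori_bound.
Proof.
move=> t0 Xpi; have [X0 Y0 dX dY] := XY; have [cX cY] := traj_continuous.
have crX : continuous (fun t => r (X t)).
  by move=> z; apply: continuous_comp; [exact: cX|exact: weight_continuous].
have cnrm : continuous nrm.
  move=> z; apply: cvgD; apply: cvgM.
  - exact: cvg_cst.
  - by apply: cvgM; exact: cs_continuous.
  - by apply: cvgM; exact: crX.
  - by apply: cvgM; exact: sn_continuous.
have cQ : continuous Qf.
  move=> z; apply: cvgD.
    by apply: cvgM; [exact: cvg_cst|exact: cY].
  by apply: continuous_comp; [exact: cnrm|exact: continuous_ln].
have Xint z : 0 < z < t -> 0 < X z < pi.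
  move=> /andP[z0 zt]; rewrite -[X in X < _]X0 traj_increasing//=.
  by apply: lt_le_trans Xpi; rewrite traj_increasing// ltW.
have Q0 : `|Qf t - Qf 0| <= Cq * X t - Cq * X 0.
  have cCX : continuous (fun t => Cq * X t).
    by move=> z; apply: cvgM; [exact: cvg_cst|exact: cX].
  have dCX (z : R) : is_derive z 1 (fun t => Cq * X t) (Cq * xfield z (X z) (Y z)).
    exact: derive_scale (dX z).
  apply: (@norm_increment _ Qf (fun t => Cq * X t)
     (fun t => xfield t (X t) (Y t) * Qrate t)
     (fun t => Cq * xfield t (X t) (Y t)) 0 t t0
     (continuous_subspaceT cQ) (continuous_subspaceT cCX) _ (fun z _ => dCX z)).
  - by move=> z z0t; apply: Qf_derive; [case/andP: z0t|exact: Xint].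
  - move=> z z0t; rewrite normrM ger0_norm// mulrC; apply: ler_wpM2r => //.
    by apply: Qf_rate; exact: Xint.
have Cq0 : 0 <= Cq.
  have k0 := ltW kap_gt0; have b0 := ltW beta_gt0.
  apply: divr_ge0; last exact: ltW.
  by apply: addr_ge0; repeat (apply: mulr_ge0 => //).
have lnb z : `|ln (nrm z)| <= `|ln e0| + `|ln e1|.
  have /andP[n0 n1] := nrm_bd z.
  have l0 : ln e0 <= ln (nrm z) by rewrite ler_ln ?posrE.
  have l1 : ln (nrm z) <= ln e1.
    by rewrite ler_ln ?posrE//; apply: lt_le_trans n1.
  rewrite ler_norml; have := ler_norm (ln e1); have := ler_norm (- ln e0).
  rewrite normrN; have := normr_ge0 (ln e0); have := normr_ge0 (ln e1).
  by move=> *; apply/andP; split; lra.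
have g0 := gam_gt0.
have -> : Y t - m0 = gam / 2 * ((Qf t - Qf 0) - ln (nrm t) + ln (nrm 0)).
  by rewrite -Y0 /Qf; field; rewrite gt_eqF.
have g2 : 0 < gam / 2 by apply: divr_gt0.
rewrite /apriori_bound normrM (gtr0_norm g2); apply: ler_wpM2l; first exact: ltW.
rewrite X0 mulr0 subr0 in Q0.
have := lnb t; have := lnb 0; have : Cq * X t <= Cq * pi by rewrite ler_wpM2l.
have := ler_normD (Qf t - Qf 0 - ln (nrm t)) (ln (nrm 0)).
have := ler_normB (Qf t - Qf 0) (ln (nrm t)).
lra.
Qed.


(** By the a priori bound the amplitude does not decay while x <= pi, so dX/dt is
    at least a constant times |sin t|^gam >= sin^2 t, whose primitive is
    (t - sin t cos t) / 2: x grows linearly with the number of turns. *)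
Lemma traj_growth t : 0 <= t -> X t <= pi ->
  expR (Num.min (m0 - apriori_bound) m1) / sp1 * ((t - 1) / 2) <= X t.
Proof.
move=> t0 Xpi; have [X0 Y0 dX dY] := XY; have [cX cY] := traj_continuous.
set c := expR _ / sp1.
have sp1_gt0 : 0 < sp1.
  by have /andP[h1 h2] := speed_bd 0 0 0; apply: lt_le_trans sp0_gt0 (le_trans h1 h2).
have c0 : 0 < c by rewrite divr_gt0// expR_gt0.
pose F (t : R) := c * 2^-1 * (t - sin t * cos t).
have dF (z : R) : is_derive z 1 F (c * sin z ^+ 2).
  have := derive_scale (c * 2^-1) (derive_sub (derive_var z)
     (derive_mul (is_derive_sin z) (is_derive_cos z))).
  move/derive_eq; apply.
  transitivity (c * 2^-1 * (cos z ^+ 2 + sin z ^+ 2 - (cos z * cos z + sin z * - sin z))).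
    by rewrite cos2Dsin2.
  by field.
have : F t - F 0 <= X t - X 0.
  apply: (@le_increment _ F X (fun z => c * sin z ^+ 2)
            (fun z => xfield z (X z) (Y z)) 0 t t0 _ _
            (fun z _ => dF z) (fun z _ => dX z)).
  - by apply: continuous_subspaceT => z; exact: is_derive_continuous (dF z).
  - exact: continuous_subspaceT.
  - move=> z /andP[z0 zt].
    have Xz : X z <= pi by rewrite (le_trans _ Xpi)// traj_nondecreasing// ltW.
    have sz : sin z ^+ 2 <= zn z.
      by have := zn_ge_sqr z; rewrite {1}/sn max_l// ltW.
    have tz : expR (Num.min (m0 - apriori_bound) m1) <= tau (Y z).
      have := traj_apriori (ltW z0) Xz; rewrite ler_norml => /andP[h _].
      rewrite ler_expR le_min !ge_min lexx orbT andbT.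
      by apply/orP; left; lra.
    have /andP[_ vz] := speed_bd z (X z) (Y z).
    rewrite /c /xfield mulrAC; apply: ler_pM => //.
    + by rewrite mulr_ge0 ?sqr_ge0// expR_ge0.
    + by rewrite invr_ge0 ltW.
    + by apply: ler_pM; rewrite ?expR_ge0 ?sqr_ge0.
    + by rewrite lef_pV2 ?posrE.
rewrite X0 /F sin0 !mul0r !subr0 mulr0 subr0; apply: le_trans.
rewrite -mulrA [2^-1 * _]mulrC; apply: ler_wpM2l; first exact: ltW.
have h : sin t * cos t <= 1.
  rewrite (le_trans (ler_norm _))// normrM.
  by apply: mulr_ile1 => //; [exact: sin_max|exact: cos_max].
by lra.
Qed.

(** For a given angle t, x is arbitrarily small when the initial amplitude is. *)
Lemma traj_upper M t : (forall t x m, `|mfield t x m| <= M) -> 0 <= t ->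
  X t <= expR (m0 + M * t) / sp0 * t.
Proof.
move=> HM t0; have [X0 Y0 dX dY] := XY; have [cX cY] := traj_continuous.
have M0 : 0 <= M by apply: le_trans (HM 0 0 0).
set c := expR _ / sp0.
have dc (z : R) : is_derive z 1 (fun t => c * t) c.
  by apply: derive_eq (derive_scale c (derive_var z)) _; ring.
have : X t - X 0 <= c * t - c * 0.
  apply: (@le_increment _ X (fun t => c * t) (fun z => xfield z (X z) (Y z))
            (fun=> c) 0 t t0 _ _ (fun z _ => dX z) (fun z _ => dc z)).
  - exact: continuous_subspaceT.
  - by apply: continuous_subspaceT => z; exact: is_derive_continuous (dc z).
  - move=> z /andP[z0 zt].
    have Yz : Y z <= m0 + M * t.
      have := derive_bounded_lipschitz dY (fun s => HM _ _ _) z 0.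
      rewrite Y0 subr0 (gtr0_norm z0) => /(le_trans (ler_norm _)) h.
      have : M * z <= M * t by apply: ler_wpM2l => //; exact: ltW.
      lra.
    have /andP[vz _] := speed_bd z (X z) (Y z).
    rewrite /xfield /c -[expR _]mulr1; apply: ler_pM.
    + by rewrite mulr_ge0// ltW.
    + by rewrite invr_ge0 ltW.
    + apply: ler_pM => //; first exact: ltW.
      by rewrite ler_expR ge_min Yz.
    + by rewrite lef_pV2 ?posrE.
by rewrite X0 mulr0 !subr0.
Qed.

End OneTrajectory.

(** Intermediate value theorem in the initial amplitude m0, at the angle n pi: x is
    beyond pi for m0 = ms by traj_growth if n is large, and before pi for m0 very
    negative by traj_upper. *)
Lemma shooting ms : exists (n : nat) m0 X Y,
  [/\ m0 <= ms, trajectory m0 X Y & X (n%:R * pi) = pi].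
Proof.
have [X [Y [XY cX]]] := trajectories_exist.
have [[M HM] _ _] := adm_mfield.
pose c := expR (Num.min (ms - apriori_bound) m1) / sp1.
have sp1_gt0 : 0 < sp1.
  by have /andP[h1 h2] := speed_bd 0 0 0; apply: lt_le_trans sp0_gt0 (le_trans h1 h2).
have c0 : 0 < c by rewrite divr_gt0// expR_gt0.
pose n := (Num.truncn (1 + 2 * pi / c)).+1.
have pi2 : 2 <= pi :> R := pi_ge2 R.
have nb : 1 + 2 * pi / c <= n%:R * pi.
  have h : 1 + 2 * pi / c < n%:R by exact: truncnS_gt.
  have n0 : 0 <= n%:R :> R by exact: ler0n.
  nra.
pose t : R := n%:R * pi.
have t0 : 0 < t by rewrite mulr_gt0// ltr0n.
have big : pi <= X ms t.
  rewrite leNgt; apply/negP => lt.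
  have := traj_growth (XY ms) (ltW t0) (ltW lt); rewrite -/c.
  have : 2 * pi / c <= t - 1 by rewrite /t; lra.
  by rewrite ler_pdivrMr// => h; lra.
pose ml := Num.min ms (ln (pi * sp0 / (2 * t)) - M * t).
have small : X ml t <= pi.
  rewrite (le_trans (traj_upper (XY ml) HM (ltW t0)))//.
  have h : expR (ml + M * t) <= pi * sp0 / (2 * t).
    rewrite -[leRHS](@lnK R) ?posrE; last by rewrite divr_gt0 ?mulr_gt0.
    by rewrite ler_expR -lerBrDr ge_min lexx orbT.
  rewrite (@le_trans _ _ (pi * sp0 / (2 * t) / sp0 * t))//.
    apply: ler_wpM2r; first exact: ltW.
    by apply: ler_wpM2r => //; rewrite invr_ge0 ltW.
  rewrite (_ : _ * t = pi / 2); last by field; rewrite !gt_eqF.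
  by have := pi0; lra.
have mlms : ml <= ms by rewrite ge_min lexx.
have cXt : {within `[ml, ms], continuous (fun m => X m t)}.
  exact: continuous_subspaceT (cX _ (ltW t0)).
have between : Num.min (X ml t) (X ms t) <= pi <= Num.max (X ml t) (X ms t).
  by rewrite ge_min small/= le_max big orbT.
have [m + Xm] := IVT mlms cXt between.
rewrite in_itv/= => /andP[_ mms].
by exists n, m, (X m), (Y m); split.
Qed.


Section Profile.
Variables (m0 : R) (X Y : R -> R).
Hypothesis XY : trajectory m0 X Y.

Definition radius t := expR (gam^-1 * Y t).
Definition Uprof t := radius t * sn t.
Definition Wprof t := radius t * cs t.

Let radius_derive (t : R) :
  is_derive t 1 radius (gam^-1 * mfield t (X t) (Y t) * radius t).
Proof.
have [_ _ _ dY] := XY.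
have := @derive_comp _ expR (fun t => gam^-1 * Y t) _ _ _
  (is_derive_expR _) (derive_scale gam^-1 (dY t)).
by move/derive_eq; apply; rewrite /radius mulrC.
Qed.

Let gam_mfield (t : R) : gam^-1 * mfield t (X t) (Y t) =
  sn t * cs t * (kap / r (X t) - r (X t) * perturb t (Y t)) / speed t (X t) (Y t).
Proof.
have g0 : gam != 0 by rewrite gt_eqF// gam_gt0.
have T0 : speed t (X t) (Y t) != 0 by rewrite gt_eqF.
have rX0 := r_neq0 (X t).
by rewrite /mfield; field; rewrite g0 T0 rX0.
Qed.

Lemma U_derive (t : R) : 0 < t ->
  is_derive t 1 Uprof (kap * Wprof t / r (X t) / speed t (X t) (Y t)).
Proof.
move=> t0; have := derive_mul (radius_derive t) (sn_derive t0).
move/derive_eq; apply; rewrite gam_mfield /Wprof.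
have T0 : speed t (X t) (Y t) != 0 by rewrite gt_eqF.
have rX0 := r_neq0 (X t).
transitivity (radius t * cs t * (sn t ^+ 2 *
   (kap / r (X t) - r (X t) * perturb t (Y t)) + speed t (X t) (Y t)) /
   speed t (X t) (Y t)); first by field; rewrite ?rX0 ?T0.
have -> : sn t ^+ 2 * (kap / r (X t) - r (X t) * perturb t (Y t)) +
    speed t (X t) (Y t) = kap / r (X t) * (cs t ^+ 2 + sn t ^+ 2).
  by rewrite /speed; field.
by rewrite cs2sn2; field; rewrite ?rX0 ?T0.
Qed.

Lemma W_derive (t : R) : 0 < t -> is_derive t 1 Wprof
  (- r (X t) * Uprof t * perturb t (Y t) / speed t (X t) (Y t)).
Proof.
move=> t0; have := derive_mul (radius_derive t) (cs_derive t0).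
move/derive_eq; apply; rewrite gam_mfield /Uprof.
have T0 : speed t (X t) (Y t) != 0 by rewrite gt_eqF.
have rX0 := r_neq0 (X t).
transitivity (radius t * sn t * (cs t ^+ 2 *
   (kap / r (X t) - r (X t) * perturb t (Y t)) - speed t (X t) (Y t)) /
   speed t (X t) (Y t)); first by field; rewrite ?rX0 ?T0.
have -> : cs t ^+ 2 * (kap / r (X t) - r (X t) * perturb t (Y t)) -
    speed t (X t) (Y t) = - r (X t) * perturb t (Y t) * (cs t ^+ 2 + sn t ^+ 2).
  by rewrite /speed; field.
by rewrite cs2sn2; field; rewrite ?rX0 ?T0.
Qed.

Lemma U_power (t : R) : Y t <= m1 -> `|Uprof t| `^ gam = tau (Y t) * zn t.
Proof.
move=> Ym; rewrite /Uprof normrM powRM// gtr0_norm ?expR_gt0//.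
rewrite /radius -expRM mulrAC mulVf ?mul1r; last by rewrite gt_eqF// gam_gt0.
by rewrite /tau min_l.
Qed.

Lemma profile_continuous : [/\ continuous radius, continuous Uprof & continuous Wprof].
Proof.
have cR : continuous radius.
  by move=> t; apply: is_derive_continuous (radius_derive t).
split=> // t; apply: cvgM; try exact: cR.
  exact: sn_continuous.
exact: cs_continuous.
Qed.

End Profile.

Lemma sin_natpi (n : nat) : sin (n%:R * pi) = 0 :> R.
Proof.
elim: n => [|n IH]; first by rewrite mul0r sin0.
by rewrite -natr1 mulrDl mul1r sinDpi IH oppr0.
Qed.

(** The trajectory given by shooting starts so low that, by the a priori bound, the
    truncation is never active and R <= e. It is then read as a function of x.
    Since sin vanishes at 0 and at n pi, u vanishes at 0 and pi. *)
Theorem small_solution e : 0 < e -> exists u w : R -> R,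
  [/\ continuous u, continuous w, u 0 = 0 & u pi = 0] /\
  [/\ forall x, 0 < x < pi -> is_derive x 1 u (w x / rho x),
      forall x, 0 < x < pi ->
        is_derive x 1 w (- (rho x * (mu * u x + sublinear p (u x)))),
      forall x, `|u x| <= e & exists2 x, 0 < x < pi & u x != 0].
Proof.
move=> e_gt0; have g0 := gam_gt0.
pose top := Num.min m1 (gam * ln e).
have [n [m0 [X [Y [m0s XY XT]]]]] := shooting (top - apriori_bound).
pose T : R := n%:R * pi.
have [X0 _ dX _] := XY; have [cX cY] := traj_continuous XY.
have iX := traj_increasing XY.
have n_gt0 : (0 < n)%N.
  case: n XT @T => [|//]; rewrite mul0r X0 => /eqP.
  by rewrite eq_sym gt_eqF// pi_gt0.
have T0 : 0 < T by rewrite mulr_gt0// ltr0n.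
have XI t : 0 <= t <= T -> 0 <= X t <= pi.
  by move=> /andP[t0 tT]; rewrite -[X in X <= _ <= _]X0 -XT !(traj_nondecreasing XY).
have Ytop t : 0 <= t <= T -> Y t <= top.
  move=> tI; have /andP[t0 _] := tI; have /andP[_ Xp] := XI _ tI.
  by have := traj_apriori XY t0 Xp; rewrite ler_norml => /andP[_]; lra.
have Ym1 t : 0 <= t <= T -> Y t <= m1.
  by move/Ytop => h; rewrite (le_trans h)// ge_min lexx.
have [th [cth thI thK Xth]] := increasing_inverse T0 cX iX.
rewrite X0 -/T XT in Xth.
have [cR cU cW] := profile_continuous XY.
pose phi (t : R) := t * `|t| `^ gam.
have cphi : continuous phi.
  by move=> t; apply: is_derive_continuous (derive_signed_power t g0).
pose u x := phi (Uprof Y (th x)); pose w x := Wprof Y (th x).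
have cu : continuous u.
  have cphiU : continuous (fun t => phi (Uprof Y t)).
    by move=> t; apply: continuous_comp; [exact: cU|exact: cphi].
  by move=> x; exact: (continuous_comp (cth x) (cphiU _)).
have cw : continuous w by move=> x; exact: (continuous_comp (cth x) (cW _)).
have csu : continuous (fun x => sublinear p (u x)).
  exact: sublinear_comp_continuous p0 cu.
have u0E : u 0 = 0.
  rewrite /u -X0 thK ?lexx ?(ltW T0)// /Uprof /sn max_l// sin0 mulr0.
  by rewrite /phi mul0r.
have upE : u pi = 0.
  rewrite /u -{1}XT -/T thK ?lexx ?(ltW T0)// /Uprof /sn max_l ?(ltW T0)//.
  by rewrite sin_natpi mulr0 /phi mul0r.
have thX t : 0 < t < T -> th (X t) = t.
  by move=> /andP[t0 tT]; rewrite thK// !ltW.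
have rE x : 0 < x < pi -> r x = rho x.
  by move=> /andP[x0 xp]; rewrite /weight clamp_id// !ltW.
have X0T x : 0 < x < pi -> X 0 < x < X T by rewrite X0 XT.
have kg : (1 + gam) * kap = 1.
  by rewrite /gam /kap; field; have := p0; lra.
exists u, w; split=> //; split.
- move=> x xI; rewrite -(rE x xI).
  apply: (@derive_reparametrized _ X (fun t => xfield t (X t) (Y t))
     (fun t => phi (Uprof Y t)) (fun x => w x / r x) th 0 T (ltW T0)) => //.
  + by move=> t; apply: continuous_comp; [exact: cU|exact: cphi].
  + move=> z; apply: cvgM; first exact: cw.
    by apply: cvgV => //; exact: weight_continuous.
  + move=> t tI; have /andP[t0 tT] := tI.
    have := derive_comp (derive_signed_power (Uprof Y t) g0) (U_derive XY t0).
    move/derive_eq; apply; rewrite /w thX// U_power; last by rewrite Ym1// !ltW.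
    transitivity ((1 + gam) * kap * (Wprof Y t / r (X t) * xfield t (X t) (Y t))).
      by rewrite /xfield; ring.
    by rewrite kg mul1r.
  + by rewrite X0 XT.
  + exact: X0T.
- move=> x xI; rewrite -(rE x xI).
  apply: (@derive_reparametrized _ X (fun t => xfield t (X t) (Y t))
     (Wprof Y) (fun x => - (r x * (mu * u x + sublinear p (u x)))) th 0 T (ltW T0)) => //.
  + move=> z; apply: cvgN; apply: cvgM; first exact: weight_continuous.
    apply: cvgD; first by apply: cvgM; [exact: cvg_cst|exact: cu].
    exact: csu.
  + move=> t tI; have /andP[t0 tT] := tI.
    have := W_derive XY t0; move/derive_eq; apply.
    rewrite /u thX//.
    have Ut : `|Uprof Y t| `^ gam = tau (Y t) * zn t.
      by rewrite U_power// Ym1// !ltW.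
    have sub := sublinear_signed_power (Uprof Y t) hp.
    rewrite /= -/gam Ut in sub.
    rewrite /xfield /phi Ut.
    transitivity (- r (X t) * (mu * (Uprof Y t * (tau (Y t) * zn t)) * (tau (Y t) * zn t) +
       sublinear p (Uprof Y t * (tau (Y t) * zn t)) * (tau (Y t) * zn t)) / speed t (X t) (Y t)).
      by rewrite sub /perturb; ring.
    by ring.
  + by rewrite X0 XT.
  + exact: X0T.
- move=> x; rewrite /u /phi normrM; set t := th x.
  have tI : 0 <= t <= T by exact: thI.
  have Rt : radius Y t <= e.
    rewrite -[leRHS](@lnK R) ?posrE// ler_expR.
    rewrite ler_pdivrMl//; apply: le_trans (Ytop _ tI) _.
    by rewrite ge_min lexx orbT.
  have UR : `|Uprof Y t| <= e.
    rewrite /Uprof normrM gtr0_norm ?expR_gt0//; apply: le_trans Rt.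
    by rewrite ler_piMr ?expR_ge0.
  rewrite (ger0_norm (powR_ge0 _ _)) U_power ?Ym1//.
  apply: le_trans UR; rewrite ler_piMr//.
  by apply: mulr_ile1 => //; exact: ltW.
- have pT : 0 < (pi / 2 : R) < T.
    have := pi_gt0 R; have : 1 <= n%:R :> R by rewrite ler1n.
    by rewrite /T => *; apply/andP; split; nra.
  have /andP[h0 hT] := pT.
  exists (X (pi / 2)).
    apply/andP; split; first by rewrite -[ltLHS]X0; apply: iX.
    by rewrite -[ltRHS]XT; apply: iX => //; exact: ltW.
  rewrite /u thX// /phi /Uprof /sn max_l ?(ltW h0)// sin_pihalf mulr1.
  rewrite mulf_neq0//; first by rewrite gt_eqF// expR_gt0.
  by rewrite gt_eqF// powR_gt0// normr_gt0 gt_eqF// expR_gt0.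
Qed.

End Shooting.

(** * Integration over the rectangle *)

Section Plane.
Variable R : realType.
Local Notation plane := (measurableTypeR R * measurableTypeR R)%type.

(** The plane carries the product sigma-algebra: an open set belongs to it, being a
    countable union of boxes with rational vertices. *)
Lemma open_plane_measurable (U : set (R * R)) : open U ->
  measurable (U : set plane).
Proof.
move=> oU.
pose box (q : (rat * rat) * (rat * rat)) : set plane :=
  `]ratr q.1.1, ratr q.1.2[%classic `*` `]ratr q.2.1, ratr q.2.2[%classic.
pose F q : set plane := [set z | box q z /\ box q `<=` (U : set plane)].
have -> : (U : set plane) = \bigcup_q F q.
  apply/seteqP; split=> [[x y] Uxy|z [q _ [qz]]]; last exact.
  have /nbhs_ballP[e /= e0 He] : nbhs ((x, y) : R * R) U by exact: open_nbhs_nbhs.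
  have pick (s : R) : exists q : rat * rat,
      [/\ s - e < ratr q.1, ratr q.1 < s, s < ratr q.2 & ratr q.2 < s + e].
    have [q1] : exists q, ratr q \in `]s - e, s[ by apply: rat_in_itvoo; lra.
    have [q2] : exists q, ratr q \in `]s, s + e[ by apply: rat_in_itvoo; lra.
    rewrite !in_itv/= => /andP[? ?] /andP[? ?].
    by exists (q1, q2); split.
  have [[a b] /= [a1 a2 b1 b2]] := pick x; have [[c d] /= [c1 c2 d1 d2]] := pick y.
  exists ((a, b), (c, d)) => //; split.
    by split; rewrite /= in_itv/=; apply/andP; split.
  move=> [s t] [/=]; rewrite !in_itv/= => /andP[s1 s2] /andP[t1 t2].
  apply: He; split; rewrite /ball/= ltr_norml; apply/andP; split; lra.
apply: countable_bigcupT_measurable => // q.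
have [sub|nsub] := pselect (box q `<=` (U : set plane)).
  rewrite (_ : F q = box q); first by apply: measurableX; exact: measurable_itv.
  by apply/seteqP; split=> [z []|z bz].
rewrite (_ : F q = set0)//.
by apply/seteqP; split=> [z []|].
Qed.

Lemma continuous_plane_measurable (F : R * R -> R) (A : set plane) :
  continuous F -> measurable A -> measurable_fun A (F : plane -> measurableTypeR R).
Proof.
move=> /continuousP cF mA; apply: (measurability _ (RGenOpens.measurableE R)).
move=> _ [_ [a [b ->] <-]]; apply: measurableI => //.
by apply: open_plane_measurable; apply: cF; exact: interval_open.
Qed.

Variable T : R.
Hypothesis T0 : 0 < T.

Lemma Omega_measurable : measurable (Omega T : set plane).
Proof. by apply: measurableX; exact: measurable_itv. Qed.

Lemma Omega_measure : leb2 (Omega T : set plane) = (T * pi)%:E.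
Proof.
apply: etrans (product_measure1E _ _ _ _) _; [exact: measurable_itv..|].
rewrite /= !lebesgue_measure_itv/= !lte_fin T0 pi_gt0 !sube0.
by rewrite -EFinM.
Qed.

Lemma bounded_on_Omega (F : R * R -> R) : continuous F ->
  exists M, forall z, Omega T z -> `|F z| <= M.
Proof.
move=> cF; have cK : compact (`[0, T]%classic `*` `[0, pi]%classic : set (R * R)).
  by apply: compact_setX; exact: segment_compact.
have [M [_ HM]] := compact_bounded (continuous_compact (continuous_subspaceT cF) cK).
exists (M + 1) => -[t x] [/=]; rewrite !in_itv/= => /andP[t0 tT] /andP[x0 xp].
apply: (HM (M + 1)); first by rewrite ltrDl.
by exists (t, x) => //; split; rewrite /= in_itv/= !ltW.
Qed.

Lemma continuous_Omega_integrable (F : R * R -> R) : continuous F ->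
  (leb2 : {measure set plane -> \bar R}).-integrable (Omega T) (EFin \o F).
Proof.
move=> cF; have [M HM] := bounded_on_Omega cF.
apply: measurable_bounded_integrable.
- exact: Omega_measurable.
- by rewrite Omega_measure ltry.
- by apply: continuous_plane_measurable; [exact: cF|exact: Omega_measurable].
- exists M; split; rewrite ?num_real// => k Mk z Oz /=.
  by rewrite (le_trans (HM z Oz))// ltW.
Qed.

Let patchE (F : R * R -> R) (t x : R) :
  ((EFin \o F) \_ (Omega T)) (t, x) =
  (if (0 < t < T) && (0 < x < pi) then (F (t, x))%:E else 0%E).
Proof.
rewrite patchE; case: ifPn => [/set_mem[/=]|].
  by rewrite !in_itv/= => -> ->.
case: ifPn => // h; rewrite notin_setE => -[]; split=> /=; rewrite in_itv/=.
  by case/andP: h.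
by case/andP: h.
Qed.

Lemma Rintegral_Omega_zero_x (F : R * R -> R) : continuous F ->
  (forall t, 0 < t < T ->
     (\int[lebesgue_measure]_(x in `]0%R, pi[) (F (t, x))%:E = 0)%E) ->
  \int[leb2]_(z in Omega T) F z = 0.
Proof.
move=> cF F0; rewrite /Rintegral.
have iF := continuous_Omega_integrable cF.
rewrite integral_mkcond/=.
have iF' : (leb2 : {measure set plane -> \bar R}).-integrable setT
    ((EFin \o F) \_ (Omega T)).
  by apply/(integrable_mkcond _ _).1 => //; exact: Omega_measurable.
rewrite -[X in fine X]/(\int[leb2]_z ((EFin \o F) \_ (Omega T)) z)%E.
rewrite /leb2 -integral12_prod_meas1//= integral0_eq// => t _.
have [tI|tI] := boolP (0 < t < T); last first.
  by apply: integral0_eq => x _; rewrite patchE (negbTE tI).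
rewrite -[RHS](F0 t tI) [RHS]integral_mkcond; apply: eq_integral => x _.
rewrite patchE tI/= /patch; case: ifPn => xI.
  by rewrite mem_set//= in_itv.
by rewrite memNset//= in_itv/=; exact/negP.
Qed.

Lemma Rintegral_Omega_zero_t (F : R * R -> R) : continuous F ->
  (forall x, 0 < x < pi ->
     (\int[lebesgue_measure]_(t in `]0%R, T[) (F (t, x))%:E = 0)%E) ->
  \int[leb2]_(z in Omega T) F z = 0.
Proof.
move=> cF F0; rewrite /Rintegral.
have iF := continuous_Omega_integrable cF.
rewrite integral_mkcond/=.
have iF' : (leb2 : {measure set plane -> \bar R}).-integrable setT
    ((EFin \o F) \_ (Omega T)).
  by apply/(integrable_mkcond _ _).1 => //; exact: Omega_measurable.
rewrite -[X in fine X]/(\int[leb2]_z ((EFin \o F) \_ (Omega T)) z)%E.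
rewrite /leb2 -integral21_prod_meas1//= integral0_eq// => x _.
have [xI|xI] := boolP (0 < x < pi); last first.
  by apply: integral0_eq => t _; rewrite patchE (negbTE xI) andbF.
rewrite -[RHS](F0 x xI) [RHS]integral_mkcond; apply: eq_integral => t _.
rewrite patchE xI andbT/= /patch; case: ifPn => tI.
  by rewrite mem_set//= in_itv.
by rewrite memNset//= in_itv/=; exact/negP.
Qed.

End Plane.

(** * Solutions of the Dirichlet problem are weak solutions *)

(** A solution u of the Dirichlet problem, with w = rho u', seen as a function on
    the rectangle that does not depend on t. *)
Section Stationary.
Variables (R : realType) (T mu p a1 a2 : R) (rho drho u w : R -> R).
Hypothesis T0 : 0 < T.
Hypothesis p0 : 0 < p.
Hypothesis a10 : a1 != 0.
Hypothesis a20 : a2 != 0.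
Hypothesis rho_gt0 : forall x, 0 <= x <= pi -> 0 < rho x.
Hypothesis rho_cont : {within `[0, pi], continuous rho}.
Hypothesis drho_cont : {within `[0, pi], continuous drho}.
Hypothesis rho_derive : forall x, 0 < x < pi -> is_derive x 1 rho (drho x).
Hypothesis cu : continuous u.
Hypothesis cw : continuous w.
Hypothesis u0 : u 0 = 0.
Hypothesis upi : u pi = 0.
Hypothesis du : forall x, 0 < x < pi -> is_derive x 1 u (w x / rho x).
Hypothesis dw : forall x, 0 < x < pi ->
  is_derive x 1 w (- (rho x * (mu * u x + sublinear p (u x)))).

Let r := rho \o clamp 0 pi.
Let dr := drho \o clamp 0 pi.
Let cr : continuous r.
Proof. by apply: continuous_clamp => //; exact: pi_ge0. Qed.
Let cdr : continuous dr.
Proof. by apply: continuous_clamp => //; exact: pi_ge0. Qed.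

Let fst_continuous (f : R -> R) : continuous f -> continuous (fun z : R * R => f z.1).
Proof.
move=> cf z; have cz : {for z, continuous (fst : R * R -> R)} by exact: cvg_fst.
exact: (continuous_comp cz (cf z.1)).
Qed.

Let snd_continuous (f : R -> R) : continuous f -> continuous (fun z : R * R => f z.2).
Proof.
move=> cf z; have cz : {for z, continuous (snd : R * R -> R)} by exact: cvg_snd.
exact: (continuous_comp cz (cf z.2)).
Qed.

Let pair_continuous (S : topologicalType) (f g : S -> R) :
  continuous f -> continuous g -> continuous (fun s => (f s, g s)).
Proof.
move=> cf cg s; apply: (@cvg_pair _ _ _ (nbhs s) (nbhs (f s)) (nbhs (g s))).
  exact: cf.
exact: cg.
Qed.

Let stat (z : R * R) : R := u z.2.

Let OmegaE z : Omega T z -> (0 < z.1 < T) && (0 < z.2 < pi).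
Proof. by case: z => t x [/=]; rewrite !in_itv/= => -> ->. Qed.

Let rE x : 0 < x < pi -> r x = rho x.
Proof. by move=> /andP[x0 xp]; rewrite /r /= clamp_id// !ltW. Qed.
Let drE x : 0 < x < pi -> dr x = drho x.
Proof. by move=> /andP[x0 xp]; rewrite /dr /= clamp_id// !ltW. Qed.

Let density q (z : R * R) : R := `|u z.2| `^ q * r z.2.

Let density_continuous q : 0 < q -> continuous (density q).
Proof.
move=> q0; have cq : continuous (fun x : R => `|u x| `^ q).
  move=> x; have cs := @norm_powR_continuous R q q0 (u x).
  exact: (continuous_comp (@cu x) cs).
by move=> z; apply: cvgM; [exact: (snd_continuous cq)|exact: (snd_continuous cr)].
Qed.

Let massE q : Lr_mass rho T q stat = (\int[leb2]_(z in Omega T) (density q z)%:E)%E.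
Proof.
apply: eq_integral => z /set_mem /OmegaE /andP[_ xI].
by rewrite /density rE.
Qed.

Lemma stationary_mass_le q e beta : 0 < q -> (forall x, `|u x| <= e) ->
  (forall x, 0 <= x <= pi -> rho x <= beta) ->
  (Lr_mass rho T q stat <= (e `^ q * beta * (T * pi))%:E)%E.
Proof.
move=> q0 ue rb; rewrite massE.
have e0 : 0 <= e by apply: le_trans (ue 0).
rewrite (@le_trans _ _ (\int[leb2]_(z in Omega T) (cst (e `^ q * beta)%:E z))%E)//.
  apply: ge0_le_integral.
  - exact: Omega_measurable.
  - move=> z /OmegaE /andP[_ /andP[x0 xp]]; rewrite lee_fin mulr_ge0 ?powR_ge0//.
    by rewrite /r /= ltW// rho_gt0// clamp_itv// pi_ge0.
  - apply/measurable_EFinP; apply: continuous_plane_measurable.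
      exact: density_continuous.
    exact: Omega_measurable.
  - exact: measurable_cst.
  - move=> z /OmegaE /andP[_ /andP[x0 xp]]; rewrite lee_fin /density.
    have rI : 0 <= clamp 0 pi z.2 <= pi by apply: clamp_itv; exact: pi_ge0.
    apply: ler_pM; rewrite ?powR_ge0//.
    + by rewrite /r /= ltW// rho_gt0.
    + by apply: ge0_ler_powR; rewrite ?nnegrE// ltW.
    + exact: rb.
by rewrite integral_cst; [rewrite Omega_measure// -EFinM|exact: Omega_measurable].
Qed.

Lemma stationary_in_Lr q : 0 < q -> in_Lr rho T q stat.
Proof.
move=> q0; split.
  apply: continuous_plane_measurable; first exact: snd_continuous.
  exact: Omega_measurable.
rewrite massE; apply: integrable_lty; first exact: Omega_measurable.
by apply: continuous_Omega_integrable => //; exact: density_continuous.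
Qed.

Section TestFunction.
Variable D : nat -> nat -> R -> R -> R.
Hypothesis DP : Psi a1 0 a2 0 T D.

Let Dc i j (z : R * R) : R := D i j (clamp 0 T z.1) (clamp 0 pi z.2).

Let Dc_continuous i j : continuous (Dc i j).
Proof.
have [sm _ _ _ _] := DP; have [cD _ _] := sm i j.
apply: (@continuous_retraction _ _ (`[0, T] `*` `[0, pi])
  (fun z : R * R => (clamp 0 T z.1, clamp 0 pi z.2))
  (fun z : R * R => D i j z.1 z.2)) => //.
- apply: pair_continuous; first exact: (fst_continuous (@clamp_continuous _ 0 T)).
  exact: (snd_continuous (@clamp_continuous _ 0 pi)).
- move=> z; split; rewrite /= in_itv/=; apply: clamp_itv; first exact: ltW.
  exact: pi_ge0.
Qed.

Let DcE i j z : Omega T z -> Dc i j z = D i j z.1 z.2.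
Proof.
move=> /OmegaE /andP[/andP[t0 tT] /andP[x0 xp]].
by rewrite /Dc !clamp_id// !ltW.
Qed.

(** The integrand of the weak equation is A - B, where A is a derivative in t and B
    a derivative in x. *)
Let A z := u z.2 * r z.2 * Dc 2 0 z.
Let B z := u z.2 * (dr z.2 * Dc 0 1 z + r z.2 * Dc 0 2 z)
  + r z.2 * (mu * u z.2 + sublinear p (u z.2)) * Dc 0 0 z.

Let cA : continuous A.
Proof.
move=> z; apply: cvgM; last exact: Dc_continuous.
by apply: cvgM; [exact: (snd_continuous cu)|exact: (snd_continuous cr)].
Qed.

Let c_reaction : continuous (fun x => mu * u x + sublinear p (u x)).
Proof.
move=> x; apply: cvgD; last exact: sublinear_comp_continuous.
by apply: cvgM; [exact: cvg_cst|exact: cu].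
Qed.

Let cB1 : continuous (fun z => u z.2 * (dr z.2 * Dc 0 1 z + r z.2 * Dc 0 2 z)).
Proof.
move=> z; apply: cvgM; first exact: (snd_continuous cu).
apply: cvgD; apply: cvgM; try exact: Dc_continuous.
  exact: (snd_continuous cdr).
exact: (snd_continuous cr).
Qed.

Let cB2 : continuous (fun z => r z.2 * (mu * u z.2 + sublinear p (u z.2)) * Dc 0 0 z).
Proof.
move=> z; apply: cvgM; last exact: Dc_continuous.
apply: cvgM; first exact: (snd_continuous cr).
exact: (snd_continuous c_reaction).
Qed.

Let cB : continuous B.
Proof. by move=> z; apply: cvgD; [exact: cB1|exact: cB2]. Qed.

Let fibre_x (F : R * R -> R) t : continuous F -> continuous (fun x => F (t, x)).
Proof.
move=> cF x; have cp : {for x, continuous (fun x : R => (t, x))}.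
  by apply: pair_continuous => ?; [exact: cvg_cst|exact: cvg_id].
exact: (continuous_comp cp (cF _)).
Qed.

Let fibre_t (F : R * R -> R) x : continuous F -> continuous (fun t => F (t, x)).
Proof.
move=> cF t; have cp : {for t, continuous (fun t : R => (t, x))}.
  by apply: pair_continuous => ?; [exact: cvg_id|exact: cvg_cst].
exact: (continuous_comp cp (cF _)).
Qed.

(** On each line x = constant, A is the derivative of u rho psi_t, which is periodic
    in t. *)
Let A_zero : \int[leb2]_(z in Omega T) A z = 0.
Proof.
have [sm _ _ _ per] := DP.
apply: Rintegral_Omega_zero_t => // x xI; have /andP[x0 xp] := xI.
pose G t := u x * r x * Dc 1 0 (t, x).
have dG t : 0 < t < T -> is_derive t 1 G (A (t, x)).
  move=> tI; have [_ dt _] := sm 1%N 0%N.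
  apply: derive_scale; rewrite DcE; last by split; rewrite /= in_itv/=.
  apply: (@derive_clamp _ (fun s => D 1 0 s (clamp 0 pi x))) => //.
  rewrite /= clamp_id ?ltW//; apply: dt.
  by split; rewrite /= in_itv/=.
rewrite (@integral_FTC _ (fun t => A (t, x)) G)//.
- rewrite /G /Dc /= !clamp_id ?lexx ?(ltW T0) ?(ltW x0) ?(ltW xp)//.
  by rewrite per ?(ltW x0) ?(ltW xp)// subrr.
- by apply: continuous_subspaceT; exact: fibre_t.
- apply: continuous_subspaceT => t; apply: cvgM; first exact: cvg_cst.
  by apply: (@fibre_t (Dc 1 0)); exact: Dc_continuous.
Qed.

(** On each line t = constant, B is the derivative of u rho psi_x - w psi, which
    vanishes at 0 and pi as u and psi do. *)
Let B_zero : \int[leb2]_(z in Omega T) B z = 0.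
Proof.
have [sm bc0 bcpi _ _] := DP.
apply: Rintegral_Omega_zero_x => // t tI; have /andP[t0 tT] := tI.
have tc : clamp 0 T t = t by rewrite clamp_id// !ltW.
have tI' : 0 <= t <= T by rewrite !ltW.
pose G x := u x * (r x * Dc 0 1 (t, x)) - w x * Dc 0 0 (t, x).
have dD j (x : R) : 0 < x < pi ->
    is_derive x 1 (fun y => Dc 0 j (t, y)) (Dc 0 j.+1 (t, x)).
  move=> xI; have [_ _ dx] := sm 0%N j.
  rewrite DcE; last by split; rewrite /= in_itv/=.
  rewrite /Dc /= tc; apply: (@derive_clamp _ (fun y => D 0 j t y)) => //.
  by apply: dx; split; rewrite /= in_itv/=.
have dG (x : R) : 0 < x < pi -> is_derive x 1 G (B (t, x)).
  move=> xI; have /andP[x0 xp] := xI.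
  have drx : is_derive x 1 r (dr x).
    by rewrite drE//; apply: derive_clamp => //; exact: rho_derive.
  have := derive_sub (derive_mul (du xI) (derive_mul drx (dD 1%N x xI)))
                     (derive_mul (dw xI) (dD 0%N x xI)).
  move/derive_eq; apply; rewrite /B /= -(rE xI).
  have rx0 : r x != 0 by rewrite rE// gt_eqF// rho_gt0// !ltW.
  by field.
rewrite (@integral_FTC _ (fun x => B (t, x)) G)//.
- have D0 : D 0 0 t 0 = 0.
    by have := bc0 t tI'; rewrite mul0r addr0 => /eqP; rewrite mulf_eq0 (negbTE a10) => /eqP.
  have Dpi : D 0 0 t pi = 0.
    by have := bcpi t tI'; rewrite mul0r addr0 => /eqP; rewrite mulf_eq0 (negbTE a20) => /eqP.
  rewrite /G /Dc /= !tc !clamp_id ?lexx ?pi_ge0//.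
  by rewrite D0 Dpi u0 upi !mul0r !mulr0 !subrr.
- exact: pi_gt0.
- by apply: continuous_subspaceT; exact: fibre_x.
- apply: continuous_subspaceT => x; apply: cvgB; apply: cvgM.
  + exact: cu.
  + by apply: cvgM; [exact: cr|apply: (@fibre_x (Dc 0 1)); exact: Dc_continuous].
  + exact: cw.
  + by apply: (@fibre_x (Dc 0 0)); exact: Dc_continuous.
Qed.

Lemma stationary_weak_equation :
    \int[leb2]_(z in Omega T)
       (stat z * (rho z.2 * D 2%N 0%N z.1 z.2
               - derive1 (fun x => rho x * D 0%N 1%N z.1 x) z.2))
    - \int[leb2]_(z in Omega T)
       ((mu * stat z + `|stat z| `^ (p - 1) * stat z) * D 0%N 0%N z.1 z.2 * rho z.2)
    = 0.
Proof.
have [sm _ _ _ _] := DP.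
pose B1 z := u z.2 * (dr z.2 * Dc 0 1 z + r z.2 * Dc 0 2 z).
pose B2 z := r z.2 * (mu * u z.2 + sublinear p (u z.2)) * Dc 0 0 z.
have iA := continuous_Omega_integrable T0 cA.
have iB := continuous_Omega_integrable T0 cB.
have iB1 := continuous_Omega_integrable T0 cB1.
have iB2 := continuous_Omega_integrable T0 cB2.
have mO := Omega_measurable T.
transitivity (\int[leb2]_(z in Omega T) (A z - B1 z) - \int[leb2]_(z in Omega T) B2 z).
  congr (_ - _); apply: eq_Rintegral => z /set_mem Oz;
    have /andP[tI xI] := OmegaE Oz; rewrite /stat.
    have [_ _ dx] := sm 0%N 1%N.
    have dz : is_derive z.2 1 (fun x => rho x * D 0 1 z.1 x)
       (drho z.2 * D 0 1 z.1 z.2 + rho z.2 * D 0 2 z.1 z.2).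
      by apply: derive_mul; [exact: rho_derive|apply: dx; case: (z) Oz].
    rewrite derive1E derive_val /A /B1 !DcE// rE// drE//; ring.
  rewrite /B2 DcE// rE// /sublinear; ring.
rewrite RintegralB// A_zero sub0r.
have : \int[leb2]_(z in Omega T) B z = 0 by exact: B_zero.
by rewrite RintegralD// => h; rewrite -opprD h oppr0.
Qed.

End TestFunction.

Lemma stationary_weak_solution :
  weak_solution rho a1 0 a2 0 T mu p (p + 1) stat.
Proof.
split; first by apply: stationary_in_Lr; exact: addr_gt0.
by move=> D DP; exact: stationary_weak_equation.
Qed.

End Stationary.

(** * Infinitely many solutions *)

(** By continuity |v| < |u| on a whole strip around x = x0, which has positive
    measure. *)
Lemma continuous_ae_distinct (R : realType) (T : R) (u v : R -> R) (x0 : R) :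
  0 < T -> continuous u -> 0 < x0 < pi -> (forall x, `|v x| < `|u x0|) ->
  continuous v ->
  ~ ae_equal_on_Omega T (fun z => u z.2) (fun z => v z.2).
Proof.
move=> T0 cu x0I vu cv [N [mN N0 sub]].
pose h (x : R) : R := `|u x| - `|v x|.
have ch : continuous h.
  move=> x; apply: cvgB.
    exact: (continuous_comp (cu x) (@norm_continuous _ _ (u x))).
  exact: (continuous_comp (cv x) (@norm_continuous _ _ (v x))).
have h0 : 0 < h x0 by rewrite subr_gt0 vu.
have hpos : \forall x \near x0, 0 < h x.
  have hc : h x @[x --> x0] --> h x0 by exact: ch.
  move/cvgrPdist_lt : hc => /(_ _ h0); apply: filterS => x.
  by rewrite ltr_norml => /andP[_]; lra.
have /nbhs_ballP[e /= e0 He] : \forall x \near x0, 0 < h x /\ 0 < x < pi.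
  near=> x; split.
    near: x; exact: hpos.
  by apply/andP; split; near: x; [apply: lt_nbhsr|apply: lt_nbhsl]; case/andP: x0I.
pose Q : set (measurableTypeR R * measurableTypeR R) :=
  `]0, T[%classic `*` `]x0 - e, x0 + e[%classic.
have QN : Q `<=` N.
  move=> [t x] [/= tT]; rewrite in_itv/= => /andP[xl xr].
  apply: sub => /= H.
  have [hx xI] : 0 < h x /\ 0 < x < pi.
    by apply: He; rewrite /ball/= ltr_norml; apply/andP; split; lra.
  have E : u x = v x by apply: H; split=> //=; rewrite in_itv.
  by move: hx; rewrite /h E subrr ltxx.
have mQ : measurable Q by apply: measurableX; exact: measurable_itv.
have : (leb2 Q <= leb2 N)%E by apply: le_measure; rewrite ?inE.
rewrite N0 leNgt => /negP; apply.
have -> : leb2 Q = (T * (e + e))%:E.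
  apply: etrans (product_measure1E _ _ _ _) _; [exact: measurable_itv..|].
  rewrite /= !lebesgue_measure_itv/= !lte_fin T0 (_ : x0 - e < x0 + e); last by lra.
  by rewrite sube0 -EFinB -EFinM; congr (_ * _)%:E; ring.
by rewrite lte_fin mulr_gt0// addr_gt0.
Unshelve. all: by end_near. Qed.

Lemma lower_bound_gt0 (R : realType) (f : R -> R) (a b : R) : a <= b ->
  {within `[a, b], continuous f} -> (forall x, a <= x <= b -> 0 < f x) ->
  exists2 m, 0 < m & forall x, a <= x <= b -> m <= f x.
Proof.
move=> ab cf f0; have [c cI Hc] := EVT_min ab cf.
exists (f c); first by apply: f0; move: cI; rewrite in_itv.
by move=> x xI; apply: Hc; rewrite in_itv.
Qed.

Lemma norm_bound (R : realType) (f : R -> R) (a b : R) : a <= b ->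
  {within `[a, b], continuous f} ->
  exists K, forall x, a <= x <= b -> `|f x| <= K.
Proof.
move=> ab cf; have [c _ Hc] := EVT_max ab cf; have [d _ Hd] := EVT_min ab cf.
exists (`|f c| + `|f d|) => x xI; have xI' : x \in `[a, b] by rewrite in_itv.
have := Hc x xI'; have := Hd x xI'; rewrite ler_norml => h1 h2.
have := ler_norm (f c); have := ler_norm (- f d); rewrite normrN.
have := normr_ge0 (f c); have := normr_ge0 (f d).
by move=> *; apply/andP; split; lra.
Qed.

Theorem theorem2p1 (R : realType) (a b : nat) (T : R)
  (rho drho ddrho : R -> R) (beta0 a1 b1 a2 b2 p mu : R)
  (ha : (0 < a)%N) (hb : (0 < b)%N) (hab : coprime a b)
  (hT : T = 2 * pi * a%:R / b%:R)
  (hab1 : a1 ^+ 2 + b1 ^+ 2 != 0) (hab2 : a2 ^+ 2 + b2 ^+ 2 != 0)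
  (hH2 : H2_0pi rho drho ddrho)
  (hrho : forall x, 0 <= x <= pi -> 0 < rho x <= beta0)
  (hrho0 : (0 < rho_0 rho drho ddrho)%E)
  (hp : 0 < p < 1)
  (halpha1 : 0 < alpha1 rho drho a1 b1) (hbeta1 : beta1 b1 = 0)
  (halpha2 : 0 < alpha2 rho drho a2 b2) (hbeta2 : beta2 b2 = 0)
  (hmu : ~ Lambda rho a1 b1 a2 b2 T mu)
  (hmu1 : rho_1 rho drho ddrho < mu) :
  exists u : nat -> R * R -> R,
    [/\ forall l, weak_solution rho a1 b1 a2 b2 T mu p (p + 1) (u l),
        forall l m, l <> m -> ~ ae_equal_on_Omega T (u l) (u m) &
        (fun l => Lr_mass rho T (p + 1) (u l)) @ \oo --> (0 : \bar R)%E].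
Proof.
have b10 : b1 = 0 by apply/eqP; rewrite -oppr_eq0; apply/eqP; exact: hbeta1.
have b20 : b2 = 0 by exact: hbeta2.
move: halpha1 halpha2; rewrite /alpha1 /alpha2 b10 b20 !mul0r !subr0 => a1_gt0 a2_gt0.
have T0 : 0 < T.
  by rewrite hT divr_gt0 ?ltr0n// mulr_gt0 ?ltr0n// mulr_gt0// pi_gt0.
have pi0 := ltW (@pi_gt0 R).
have [_ [wrho _ crho cdrho]] := hH2.
have drhoE := weak_derivative_classical crho cdrho wrho.
have rho_gt0 x : 0 <= x <= pi -> 0 < rho x by move/hrho/andP => [].
have [r0 r0_gt0 r0_le] := lower_bound_gt0 pi0 crho rho_gt0.
have rho_bd x : 0 <= x <= pi -> r0 <= rho x <= beta0.
  by move=> xI; rewrite r0_le//; case/andP: (hrho x xI).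
have [K HK] := norm_bound pi0 cdrho.
have drho_bd x : 0 < x < pi -> `|drho x| <= K.
  by move=> /andP[x0 xp]; rewrite HK// !ltW.
have p0 : 0 < p by case/andP: hp.
have p10 : 0 < p + 1 by rewrite addr_gt0.
pose stat (u : R -> R) (z : R * R) := u z.2.
pose good (ux : (R -> R) * R) (e : R) : Prop :=
  [/\ continuous ux.1, 0 < ux.2 < pi /\ ux.1 ux.2 != 0,
      forall x, `|ux.1 x| <= e,
      weak_solution rho a1 0 a2 0 T mu p (p + 1) (stat ux.1) &
      (Lr_mass rho T (p + 1)%R (stat ux.1) <= (e `^ (p + 1) * beta0 * (T * pi))%:E)%E].
have /choice[S HS] : forall e, exists ux, 0 < e -> good ux e.
  move=> e; have [e0|e0] := ltP 0 e; last by exists (id, 0).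
  have [u [w [[cu cw u0 upi] [du dw ue [x0 x0I ux0]]]]] :=
    small_solution mu hp r0_gt0 rho_bd crho drhoE drho_bd e0.
  exists (u, x0) => _; split=> //.
    by apply: (@stationary_weak_solution _ _ _ _ _ _ _ drho u w) => //; rewrite gt_eqF.
  apply: (stationary_mass_le T0 rho_gt0 crho cu p10 ue).
  by move=> x /rho_bd /andP[].
(* Each solution is bounded by half of a value taken by the preceding one. This
   makes them pairwise distinct, and the bounds eps n decay geometrically. *)
pose step (e : R) := `|(S e).1 (S e).2| / 2.
pose eps n := iter n step 1.
have step_gt0 e : 0 < e -> 0 < step e.
  by move=> /HS[_ [_ n0] _ _ _]; rewrite divr_gt0// normr_gt0.
have step_le e : 0 < e -> step e <= e / 2.
  by move=> /HS[_ _ h _ _]; rewrite ler_pM2r.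
have eps_gt0 n : 0 < eps n by elim: n => //= n /step_gt0.
have eps_dec : {homo eps : m n / (m <= n)%N >-> n <= m}.
  apply: homo_leq => [//|? ? ? /[swap]|n]; first exact: le_trans.
  by have := step_le _ (eps_gt0 n); have := eps_gt0 n; rewrite /= -/(eps n) => ? ?; lra.
have eps_le n : eps n <= 2^-1 ^+ n.
  elim: n => [|n IH]; first by rewrite expr0.
  have := step_le _ (eps_gt0 n); rewrite /= -/(eps n) exprS => h; lra.
exists (fun n => stat (S (eps n)).1); split.
- by move=> l; have [] := HS _ (eps_gt0 l).
- have lt_distinct l m : (l < m)%N ->
    ~ ae_equal_on_Omega T (stat (S (eps l)).1) (stat (S (eps m)).1).
    move=> lm; have [cl [xI ul0] _ _ _] := HS _ (eps_gt0 l).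
    have [cm _ um _ _] := HS _ (eps_gt0 m).
    apply: (continuous_ae_distinct T0 cl xI) => // x.
    rewrite (le_lt_trans (um x))// (le_lt_trans (eps_dec _ _ lm))//=.
    by rewrite /step ltr_pdivrMr// ltr_pMr ?normr_gt0// ltr1n.
  move=> l m /eqP; rewrite neq_ltn => /orP[lm|ml]; first exact: lt_distinct.
  move=> E; apply: (lt_distinct _ _ ml).
  case: E => N [mN N0 sub]; exists N; split=> // z nz; apply: sub => h.
  by apply: nz => Oz; rewrite h.
- apply: (@squeeze_cvge _ _ _ _ (cst 0%E) _
    (fun n => (beta0 * (T * pi) * 2^-1 ^+ n)%:E)).
  + near=> n; have [_ _ _ _ h] := HS _ (eps_gt0 n).
    apply/andP; split.
      apply: integral_ge0 => -[t x] [/= _]; rewrite in_itv/= => /andP[x0 xp].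
      by rewrite lee_fin mulr_ge0 ?powR_ge0// ltW// rho_gt0// !ltW.
    apply: le_trans h _; rewrite lee_fin -mulrA mulrC.
    apply: ler_wpM2l.
      rewrite mulr_ge0 ?mulr_ge0 ?(ltW T0)//.
      have /hrho/andP[h1 h2] : 0 <= (0 : R) <= pi by rewrite lexx.
      exact: le_trans (ltW h1) h2.
    apply: le_trans (eps_le n); apply: ge1r_powR; last by rewrite lerDr ltW.
    by rewrite eps_gt0 (eps_dec 0%N n).
  + exact: cvg_cst.
  + apply: cvg_EFin; first by near=> n.
    have half : `|2^-1 : R| < 1 by rewrite ger0_norm// invf_lt1// ltr1n.
    exact: (cvg_geometric (beta0 * (T * pi)) half).
Unshelve. all: by end_near. Qed.
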